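(* Let $K$ be a compact Hausdorff space, $\varphi$ a homeomorphism of $K$ onto itself, and $\mu$ a $\varphi$-invariant regular Borel probability measure on $K$ such that $\mu(O)>0$ for any nonempty open subset $O$ of $K$. Let $X$ be a Banach ideal in $L^0(K,\mu)$ such that $Z(X)=L^\infty(K,\mu)$, the composition operator $Ux=x\circ\varphi$ is defined and bounded on $X$, and $\sigma(U)\subseteq\mathbb{T}$. Assume also that $\mu(\Pi)=0$, where $\Pi$ is the set of all $\varphi$-periodic points in $K$. Let $Y$ be an almost localized closed subspace of $X$ such that $UY=Y$. Let $w\in L^\infty(K,\mu)$ be such that $wY\subseteq Y$, and let $T=wU:Y\to Y$. Then (1) $\sigma_2(T)=\sigma_{a.p.}(T)$ is a rotation invariant subset of $\mathbb{C}$. Assume additionally that for any nonzero $y\in Y$ we have $\left|\int\ln|y|\,d\mu\right|<\infty$. Then (2) $\sigma_1(T)=\sigma_{a.p.}(T)$ and $\sigma(T)=\sigma_4(T)$.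
   Context: A Banach ideal in $L^0(K,\mu)$ (the lattice of classes of $\mu$-measurable functions) is an order ideal $X$ which is a Banach space under a lattice norm ($|x|\le|y|$ implies $\|x\|\le\|y\|$). $Z(X)$ is the ideal center of $X$ (operators dominated in modulus by a multiple of the identity); $Z(X)=L^\infty(K,\mu)$ means that it consists of multiplications by functions in $L^\infty(K,\mu)$. A closed subspace $Y$ of a Dedekind complete Banach lattice $X$ is almost localized in $X$ if for any (nonzero) band $Z$ in $X$ and any $\varepsilon>0$ there is $y\in Y$ with $\|y\|=1$ and $\|(I-P_Z)y\|<\varepsilon$, where $P_Z$ is the band projection on $Z$. $\mathbb{T}$ is the unit circle; rotation invariant means invariant under multiplication by elements of $\mathbb{T}$. All spectra of $T$ refer to $T$ as an operator on $Y$. $\sigma_{a.p.}(T)=\{\lambda:\exists y_n\in Y,\|y_n\|=1,Ty_n-\lambda y_n\to0\}$. An operator is semi-Fredholm if its range is closed and either its kernel is finite-dimensional or its range has finite codimension; it is in $\Phi_+$ if its range is closed and its kernel is finite-dimensional; Weyl if it is Fredholm of index $0$. $\sigma_1(T)$, $\sigma_2(T)$, $\sigma_4(T)$ are the sets of $\lambda\in\mathbb{C}$ for which $\lambda I-T$ is not semi-Fredholm, not in $\Phi_+$, not Weyl, respectively. *)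

(* Defs.v *)
From HB Require Import structures.
From mathcomp Require Export all_boot all_order all_algebra.
From mathcomp Require Export complex.
From mathcomp Require Export all_classical all_reals all_analysis.
Export numFieldNormedType.Exports.

Set Implicit Arguments.
Unset Strict Implicit.
Unset Printing Implicit Defensive.

Import Order.TTheory GRing.Theory Num.Theory.
Local Open Scope classical_set_scope.
Local Open Scope ring_scope.
Local Open Scope complex_scope.

Section Spectra.
Context {F : numFieldType} {E : normedModType F}.
Implicit Types (V W Y : set E) (A T : E -> E) (lam : F).

Definition linear_subspace V :=
  V 0 /\ forall a x y, V x -> V y -> V (a *: x + y).

Definition bounded_op A := exists c : F, forall x, `|A x| <= c * `|x|.

Definition has_dim V (n : nat) := exists e : 'I_n -> E,
  (forall c : 'I_n -> F, \sum_i c i *: e i = 0 -> forall i, c i = 0) /\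
  V = [set \sum_i c i *: e i | c in [set: 'I_n -> F]].

(* For subspaces W of V: the classes of e form a basis of V / W. *)
Definition has_codim V W (n : nat) := exists e : 'I_n -> E,
  [/\ forall i, V (e i),
      forall c : 'I_n -> F, W (\sum_i c i *: e i) -> forall i, c i = 0 &
      forall x, V x -> exists c : 'I_n -> F, W (x - \sum_i c i *: e i)].

(* Below, Y is a closed subspace invariant under A and T, and every notion is
   that of the restriction Y -> Y. *)

Definition ker_on Y A := [set y | Y y /\ A y = 0].
Definition range_on Y A := A @` Y.

Definition finite_dim_ker Y A := exists n, has_dim (ker_on Y A) n.
Definition finite_codim_range Y A := exists n, has_codim Y (range_on Y A) n.

Definition invertible_on Y A :=
  set_bij Y Y A /\ exists c : F, forall y, Y y -> `|y| <= c * `|A y|.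

Definition semi_Fredholm_on Y A :=
  closed (range_on Y A) /\ (finite_dim_ker Y A \/ finite_codim_range Y A).

Definition Phi_plus_on Y A := closed (range_on Y A) /\ finite_dim_ker Y A.

Definition Weyl_on Y A := closed (range_on Y A) /\
  exists n, has_dim (ker_on Y A) n /\ has_codim Y (range_on Y A) n.

Definition spectrum Y T :=
  [set lam | ~ invertible_on Y (fun y => lam *: y - T y)].

Definition sigma_ap Y T := [set lam | exists y : nat -> E,
  (forall n, Y (y n) /\ `|y n| = 1) /\
  (fun n => T (y n) - lam *: y n) @ \oo --> (0 : E)].

Definition sigma1 Y T :=
  [set lam | ~ semi_Fredholm_on Y (fun y => lam *: y - T y)].
Definition sigma2 Y T :=
  [set lam | ~ Phi_plus_on Y (fun y => lam *: y - T y)].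
Definition sigma4 Y T :=
  [set lam | ~ Weyl_on Y (fun y => lam *: y - T y)].

End Spectra.

Definition unit_circle (F : numFieldType) : set F := [set c | `|c| = 1].
Arguments unit_circle : clear implicits.

Definition rotation_invariant (F : numFieldType) (S : set F) :=
  forall c lam, unit_circle F c -> S lam -> S (c * lam).

Notation borel K := (g_sigma_algebraType (@open K)).

Section Dynamics.
Context {R : realType} {K : ptopologicalType}.
Variable mu : probability (borel K) R.
Implicit Type phi : K -> K.

Definition homeomorphism phi := continuous phi /\
  exists psi : K -> K, [/\ continuous psi, cancel phi psi & cancel psi phi].

Definition invariant_measure phi :=
  forall A : set (borel K), measurable A -> mu (phi @^-1` A) = mu A.

Definition regular_measure := forall A : set (borel K), measurable A ->
  mu A = ereal_sup [set mu C | C in [set C : set K | compact C /\ C `<=` A]] /\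
  mu A = ereal_inf [set mu O | O in [set O : set K | open O /\ A `<=` O]].

Definition periodic_points phi : set K :=
  [set k | exists n : nat, (0 < n)%N /\ iter n phi k = k].

End Dynamics.

Section BanachIdeals.
Context {R : realType} {K : ptopologicalType}.
Variable mu : probability (borel K) R.

Definition cmeasurable (f : borel K -> R[i]) :=
  measurable_fun setT (fun k => complex.Re (f k)) /\
  measurable_fun setT (fun k => complex.Im (f k)).

Definition Linfty (m : K -> R[i]) := cmeasurable m /\
  exists c : R[i], \forall k \ae mu, `|m k| <= c.

(* An ideal X of L^0(K, mu), whose elements are classes of functions, is given
   as a Banach space together with a choice [rep x] of a Borel representative
   of each class x; Banach_ideal says that x |-> class of [rep x] is linear and
   injective, that its image is an order ideal of L^0(K, mu), and that the norm
   is a lattice norm. *)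
Context {X : completeNormedModType R[i]}.
Variable rep : X -> K -> R[i].
Implicit Types (x y z : X) (Z D Y : set X) (A : X -> X) (m : K -> R[i]).

Definition le_mod x y := \forall k \ae mu, `|rep x k| <= `|rep y k|.

Record Banach_ideal : Prop := BanachIdeal {
  rep_measurable : forall x, cmeasurable (rep x);
  rep_linear : forall (a : R[i]) x y,
    \forall k \ae mu, rep (a *: x + y) k = a * rep x k + rep y k;
  rep_inj : forall x y, (\forall k \ae mu, rep x k = rep y k) -> x = y;
  rep_ideal : forall (f : K -> R[i]) x, cmeasurable f ->
    (\forall k \ae mu, `|f k| <= `|rep x k|) ->
    exists z, \forall k \ae mu, rep z k = f k;
  lattice_norm : forall x y, le_mod x y -> `|x| <= `|y| }.

Definition is_multiplication m A :=
  forall x, \forall k \ae mu, rep (A x) k = m k * rep x k.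

Definition is_composition (phi : K -> K) A :=
  forall x, \forall k \ae mu, rep (A x) k = rep x (phi k).

Definition central A := linear A /\
  exists c : R[i], forall x, \forall k \ae mu, `|rep (A x) k| <= c * `|rep x k|.

(* Z(X) = L^oo(K, mu): sending m to the multiplication by m is a bijection from
   (classes of) L^oo functions onto the ideal center. *)
Definition center_is_Linfty :=
  (forall A, central A <-> exists2 m, Linfty m & is_multiplication m A) /\
  (forall m1 m2 A, Linfty m1 -> Linfty m2 ->
     is_multiplication m1 A -> is_multiplication m2 A ->
     \forall k \ae mu, m1 k = m2 k).

(* In the order of R[i], u <= v means that v - u is a nonnegative real; hence
   le_X is the order of the complex vector lattice X, x <= y iff y - x is a
   nonnegative real function. *)
Definition le_X x y := \forall k \ae mu, rep x k <= rep y k.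

Definition is_sup D s := (forall x, D x -> le_X x s) /\
  (forall u, (forall x, D x -> le_X x u) -> le_X s u).

Definition order_ideal Z :=
  linear_subspace Z /\ forall x z, Z x -> le_mod z x -> Z z.

Definition band Z :=
  order_ideal Z /\ forall D s, D `<=` Z -> is_sup D s -> Z s.

Definition disjoint_elts x y :=
  \forall k \ae mu, Num.min `|rep x k| `|rep y k| = 0.

(* The component of x in Z for the decomposition X = Z (+) Z^d, which holds for
   every band Z since X is Dedekind complete. *)
Definition band_proj Z x : X :=
  xget 0 [set z | Z z /\ forall u, Z u -> disjoint_elts (x - z) u].

Definition almost_localized Y := forall Z, band Z -> Z <> [set 0] ->
  forall eps : R[i], 0 < eps ->
  exists y, [/\ Y y, `|y| = 1 & `|y - band_proj Z y| < eps].

(* lne is the extended logarithm, with lne 0 = -oo; an integral that does not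
   exist (oo - oo) has the value -oo, so the condition says that the integral
   exists and is finite. *)
Definition finite_log_integral x :=
  (`| \int[mu]_k lne (ComplexField.Normc.normc (rep x k))%:E | < +oo)%E.

End BanachIdeals.

(* Main.v *)
Require Import Defs.
From HB Require Import structures.
From mathcomp Require Import all_boot all_order all_algebra.
From mathcomp Require Import complex.
From mathcomp Require Import all_classical all_reals all_analysis.
From mathcomp Require Import measurable_realfun zify ring lra.

(** Why the theorem is true.

    Let [lam] be an approximate eigenvalue of [T = w U] on [Y], say with
    [|lam| = 1] after a rescaling, and let [|alpha| = 1]. If [u] is carried by a
    set [E] whose preimages under the first [2 N] iterates of [phi] are pairwise
    disjoint, then the vectors [T^j u] are disjoint functions, and the tent
<<
      y = sum_(j < 2 N) (alpha lam)^-j p^|j - N| T^j u,    p < 1,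
>>
    is an almost eigenvector for [alpha lam]: inside the tent consecutive
    coefficients differ by a factor [p] after the phases are removed, so that
    [T y - alpha lam y] is there a small multiple of [y], and the two ends carry
    the weight [p^N] ([tent_almost_eigenvector]). For this one needs [T^N u] not
    to be exponentially smaller than [u] and [T^(2 N) u]. Because the spectrum of
    [U] lies on the circle, [U] and its inverse grow subexponentially
    ([spectral_growth], itself proved with a tent along a positive orbit), and
    only the products of [N] consecutive values of [|w|] matter. They are
    balanced on a set of positive measure: otherwise an approximate eigenvector
    for [lam] would have to be small ([balanced_positive]). As almost no point is
    periodic, such a set contains a smaller one of positive measure with disjoint
    translates ([positive_wandering_subset]), and almost localization supplies a
    vector [u] of [Y] almost carried by it ([localized_eigenvectors]).

    Splitting [E] gives any number of almost eigenvectors for [alpha lam] that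
    are almost carried by disjoint sets, hence robustly independent. This proves
    rotation invariance, and shows that [lam - T] is not in [Phi_+]: by the open
    mapping theorem ([open_mapping]) its kernel would otherwise contain arbitrarily
    many independent vectors ([robust_not_Phi_plus]). Conversely, off the
    approximate point spectrum [lam - T] is bounded below, hence in [Phi_+]. The
    equality of the spectrum with [sigma_4] is a formal consequence.

    Suppose now that nonzero elements of [Y] have integrable logarithms. If
    [lam - T] had closed range of finite codimension for an approximate
    eigenvalue [lam], a perturbation argument would make every number near [lam]
    an eigenvalue ([robust_codim_eigenvalues]). But integrating the logarithm of
    [|w| |y o phi| = |lam| |y|] shows that all nonzero eigenvalues have the same
    modulus ([log_integrable_eigenvalue]), and if 0 is an eigenvalue then [w]
    vanishes almost everywhere ([kernel_zero]). *)

Set Implicit Arguments.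
Unset Strict Implicit.
Unset Printing Implicit Defensive.

Import Order.TTheory GRing.Theory Num.Theory.
Import numFieldNormedType.Exports.
Local Open Scope classical_set_scope.
Local Open Scope ring_scope.
Local Open Scope complex_scope.

(** * Real-valued norms *)

Section RealNorm.
Context {R : realType}.
Implicit Types (a b : R[i]) (r s : R).

(** The norms of [R[i]] and [X] take values in the partially ordered field
    [R[i]]; [cabs] and [rn] are the same numbers in [R]. *)
Definition cabs a : R := Normc.normc a.

Lemma normC_cabs a : `|a| = (cabs a)%:C. Proof. by []. Qed.
Lemma cabs_ge0 a : 0 <= cabs a. Proof. by case: a => x y; exact: sqrtr_ge0. Qed.
Lemma cabs0 : cabs 0 = 0. Proof. exact: Normc.normc0. Qed.
Lemma cabs1 : cabs 1 = 1. Proof. exact: Normc.normc1. Qed.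
Lemma cabsM a b : cabs (a * b) = cabs a * cabs b.
Proof. exact: Normc.normcM. Qed.
Lemma cabsV a : cabs a^-1 = (cabs a)^-1. Proof. exact: Normc.normcV. Qed.
Lemma cabsN a : cabs (- a) = cabs a. Proof. exact: normcN. Qed.
Lemma cabsD a b : cabs (a + b) <= cabs a + cabs b. Proof. exact: le_normcD. Qed.
Lemma cabsX a n : cabs (a ^+ n) = cabs a ^+ n.
Proof. by elim: n => [|n IH]; rewrite ?expr0 ?cabs1// !exprS cabsM IH. Qed.
Lemma cabs_eq0 a : (cabs a == 0) = (a == 0).
Proof.
apply/eqP/eqP => [|->]; last exact: cabs0.
exact: Normc.eq0_normc.
Qed.
Lemma cabs_gt0 a : (0 < cabs a) = (a != 0).
Proof. by rewrite lt_neqAle cabs_ge0 andbT eq_sym cabs_eq0. Qed.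
Lemma cabs_real r : cabs r%:C = `|r|.
Proof. by rewrite /cabs /= expr0n /= addr0 sqrtr_sqr. Qed.
Lemma le_cabs a b : (`|a| <= `|b|) = (cabs a <= cabs b).
Proof. by rewrite !normC_cabs lecR. Qed.
Lemma cabs_sum (I : Type) (s : seq I) (P : pred I) (F : I -> R[i]) :
  cabs (\sum_(i <- s | P i) F i) <= \sum_(i <- s | P i) cabs (F i).
Proof.
elim/big_ind2: _ => [|x1 x2 y1 y2 h1 h2|//]; first by rewrite cabs0.
by rewrite (le_trans (cabsD _ _))// lerD.
Qed.

Lemma cabs_gt0_real (e : R[i]) : 0 < e -> e = (complex.Re e)%:C /\ 0 < complex.Re e.
Proof.
case: e => x y; rewrite ltcE /= => /andP[/eqP yE x0].
by split => //; rewrite yE.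
Qed.

Context {X : normedModType R[i]}.
Implicit Types x y : X.

Definition rn x : R := complex.Re `|x|.

Lemma rnE x : `|x| = (rn x)%:C.
Proof.
have : 0 <= `|x| by [].
rewrite /rn; case: `|x| => a b; rewrite lecE /= => /andP[/eqP-> _] //.
Qed.
Lemma rn_ge0 x : 0 <= rn x. Proof. by rewrite -ler0c -rnE. Qed.
Lemma le_rn x y : (`|x| <= `|y|) = (rn x <= rn y). Proof. by rewrite !rnE lecR. Qed.
Lemma rn0 : rn 0 = 0. Proof. by rewrite /rn normr0. Qed.
Lemma rn_eq0 x : rn x = 0 -> x = 0.
Proof. by move=> h; apply/normr0_eq0; rewrite rnE h. Qed.
Lemma rn_gt0 x : x <> 0 -> 0 < rn x.
Proof.
by move=> x0; rewrite lt_neqAle rn_ge0 andbT eq_sym; apply/eqP => /rn_eq0.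
Qed.
Lemma rnN x : rn (- x) = rn x. Proof. by rewrite /rn normrN. Qed.
Lemma rnB x y : rn (x - y) = rn (y - x). Proof. by rewrite -rnN opprB. Qed.
Lemma rnD x y : rn (x + y) <= rn x + rn y.
Proof. by rewrite -lecR rmorphD /= -!rnE ler_normD. Qed.
Lemma rnD2 x y r s : rn x <= r -> rn y <= s -> rn (x + y) <= r + s.
Proof. by move=> h k; rewrite (le_trans (rnD _ _))// lerD. Qed.
Lemma rnZ a x : rn (a *: x) = cabs a * rn x.
Proof. by apply/complexI; rewrite rmorphM /= -!rnE normrZ -normC_cabs. Qed.
Lemma rn_sum (I : Type) (s : seq I) (P : pred I) (F : I -> X) :
  rn (\sum_(i <- s | P i) F i) <= \sum_(i <- s | P i) rn (F i).
Proof.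
elim/big_ind2: _ => [|x1 x2 y1 y2 h1 h2|//]; first by rewrite rn0.
by rewrite (le_trans (rnD _ _))// lerD.
Qed.
Lemma rn_triangle x y z : rn (x - z) <= rn (x - y) + rn (y - z).
Proof. by rewrite -[x - z](subrKA y) rnD. Qed.
Lemma rn_le_sub x y : rn x <= rn (x - y) + rn y.
Proof. by rewrite -{1}(subrK y x) rnD. Qed.

Definition rn_cvg (u : nat -> X) (l : X) :=
  forall e : R, 0 < e -> exists N, forall n, (N <= n)%N -> rn (u n - l) < e.

Lemma rn_cvgP u l : u @ \oo --> l <-> rn_cvg u l.
Proof.
split=> [/cvgrPdist_lt h e e0|h].
  have [//|N _ hN] := h e%:C; first by rewrite ltcR.
  exists N => n Nn; have := hN _ Nn.
  by rewrite /= rnE ltcR rnB.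
apply/cvgrPdist_lt => e e0; have [-> e0'] := cabs_gt0_real e0.
have [N hN] := h _ e0'; exists N => // n /= Nn.
by rewrite rnE ltcR rnB hN.
Qed.

Definition rn_closed (V : set X) :=
  forall x, (forall e : R, 0 < e -> exists2 y, V y & rn (x - y) < e) -> V x.

Lemma rn_closedP V : closed V -> rn_closed V.
Proof.
move=> cV x h; apply: cV => B /nbhs_ballP [e /= e0 eB].
have [eE e0'] := cabs_gt0_real e0.
have [y Vy xy] := h _ e0'; exists y; split=> //; apply: eB.
by rewrite -ball_normE /= eE rnE ltcR.
Qed.

Lemma le_rnM (c : R[i]) (x y : X) : `|x| <= c * `|y| -> rn x <= cabs c * rn y.
Proof.
rewrite !rnE => h.
have : `|c * (rn y)%:C| = (cabs c * rn y)%:C.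
  by rewrite normrM normC_cabs normC_cabs cabs_real ger0_norm ?rn_ge0// rmorphM.
rewrite ger0_norm; last by rewrite (le_trans _ h)// ler0c rn_ge0.
by move=> E; move: h; rewrite E lecR.
Qed.

Lemma bounded_opP (A : X -> X) : bounded_op A ->
  exists c : R, 0 <= c /\ forall x, rn (A x) <= c * rn x.
Proof.
case=> c h; exists (cabs c); split=> [|x]; first exact: cabs_ge0.
exact/le_rnM/h.
Qed.

Lemma unit_rn x : `|x| = 1 <-> rn x = 1.
Proof. by rewrite rnE; split=> [[->]|->]. Qed.

End RealNorm.

Lemma rn_complete {R : realType} {X : completeNormedModType R[i]}
    (u : nat -> X) :
  (forall e : R, 0 < e ->
     exists N, forall n, (N <= n)%N -> rn (u n - u N) < e) ->
  exists l, rn_cvg u l.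
Proof.
move=> h.
have : cvg (u @ \oo).
  apply: cauchy_cvg; apply: cauchy_exP => e e0.
  have [eE e0'] := cabs_gt0_real e0.
  have [N hN] := h _ e0'.
  exists (u N), N => // n /= Nn.
  by rewrite -ball_normE /= eE rnE ltcR rnB hN.
by move=> c; exists (lim (u @ \oo)); apply/rn_cvgP.
Qed.

(** * The open mapping theorem and small perturbations of surjections *)

Lemma geometric_small {R : realType} (q c e : R) : 0 <= q < 1 -> 0 < e ->
  exists N, forall n, (N <= n)%N -> c * q ^+ n < e.
Proof.
move=> /andP[q0 q1] e0; have [c0|c0] := leP c 0.
  exists 0%N => n _; apply: le_lt_trans e0.
  by rewrite mulr_le0_ge0// exprn_ge0.
have q1' : `|q| < 1 by rewrite ger0_norm.
have /cvgrPdist_lt/(_ (e / c)) := cvg_expr q1'.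
case; first by rewrite divr_gt0.
move=> N _ h; exists N => n /h /=; rewrite sub0r normrN ger0_norm ?exprn_ge0//.
by rewrite ltr_pdivlMr// mulrC.
Qed.

Lemma exp_half_small {R : realType} (c e : R) : 0 < e ->
  exists N, c * 2^-1 ^+ N < e.
Proof.
move=> e0; have q : (0 <= (2^-1 : R) < 1)%R by rewrite invr_ge0 ler0n invf_lt1 ?ltr1n.
by have [N hN] := geometric_small c q e0; exists N; exact: hN.
Qed.

(** The seminorm [p] on [V] will be the norm of [X], or that of [X] with finitely
    many scalar coordinates added; the maps are considered on the complete
    subspace [Z]. *)
Section SuccessiveApproximation.
Context {R : realType} {X : normedModType R[i]} {V : lmodType R[i]}.
Variables (p : V -> R) (Z : set V).
Hypothesis p_ge0 : forall v, 0 <= p v.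
Hypothesis pD : forall u v, p (u + v) <= p u + p v.
Hypothesis pZ : forall a v, p (a *: v) = cabs a * p v.
Hypothesis Z0 : Z 0.
Hypothesis ZL : forall a u v, Z u -> Z v -> Z (a *: u + v).
Hypothesis Zcomplete : forall u : nat -> V, (forall n, Z (u n)) ->
  (forall e : R, 0 < e ->
     exists N, forall n, (N <= n)%N -> p (u n - u N) < e) ->
  exists2 l, Z l & forall e : R, 0 < e ->
     exists N, forall n, (N <= n)%N -> p (u n - l) < e.

Let p0 : p 0 = 0. Proof. by rewrite -(scale0r 0) pZ cabs0 mul0r. Qed.
Let pN v : p (- v) = p v.
Proof. by rewrite -scaleN1r pZ cabsN cabs1 mul1r. Qed.
Let ZD u v : Z u -> Z v -> Z (u + v).
Proof. by move=> Zu Zv; rewrite -[u]scale1r; exact: ZL. Qed.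

(** Each correction halves the residual, and the corrections form a geometric
    series. *)
Lemma approximate_solutions (A : {linear V -> X}) (c : R) (B : set X) (C : R) :
  (forall v, Z v -> rn (A v) <= c * p v) -> 0 <= C ->
  (forall z, B z -> exists v, [/\ Z v, p v <= C * rn z, B (z - A v) &
     rn (z - A v) <= 2^-1 * rn z]) ->
  forall z, B z -> exists v, [/\ Z v, A v = z & p v <= 2 * C * rn z].
Proof.
move=> Ac C0 h z Bz.
pose P x v := B x -> [/\ Z v, p v <= C * rn x, B (x - A v) &
     rn (x - A v) <= 2^-1 * rn x].
have /choice[f fP] : forall x, exists v, P x v.
  by move=> x; have [/h[v vP]|nB] := pselect (B x); [exists v|exists 0].
pose y n := iter n (fun x => x - A (f x)) z.
have By n : B (y n).
  by elim: n => //= n /fP[].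
have yn n : rn (y n) <= 2^-1 ^+ n * rn z.
  elim: n => [|n IH]; first by rewrite expr0 mul1r.
  have [_ _ _ /= k] := fP _ (By n).
  by rewrite exprS -mulrA (le_trans k)// ler_wpM2l// invr_ge0.
pose s n := \sum_(i < n) f (y i).
have Zs n : Z (s n).
  elim: n => [|n IH]; first by rewrite /s big_ord0.
  by rewrite /s big_ord_recr /=; apply: ZD => //; have [] := fP _ (By n).
have As n : y n = z - A (s n).
  elim: n => [|n IH]; first by rewrite /s big_ord0 linear0 subr0.
  by rewrite /s big_ord_recr /= linearD /= opprD addrA -IH.
have sn n m : p (s (n + m)%N - s n) <=
    2 * C * rn z * (2^-1 ^+ n - 2^-1 ^+ (n + m)%N).
  elim: m => [|m IH]; first by rewrite addn0 !subrr p0 mulr0.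
  rewrite addnS {1}/s big_ord_recr /= addrAC.
  apply: (le_trans (pD _ _)); apply: (le_trans (lerD IH (lexx _))).
  have [_ k _ _] := fP _ (By (n + m)%N).
  have k2 : C * rn (y (n + m)%N) <= C * (2^-1 ^+ (n + m)%N * rn z).
    by rewrite ler_wpM2l.
  by rewrite exprS; lra.
have q0 n : 0 <= (2^-1 : R) ^+ n by rewrite exprn_ge0// invr_ge0.
have D0 : 0 <= 2 * C * rn z by rewrite mulr_ge0 ?rn_ge0// mulr_ge0.
have sn' n m : p (s (n + m)%N - s n) <= 2 * C * rn z * 2^-1 ^+ n.
  by rewrite (le_trans (sn n m))// ler_wpM2l// lerBlDr lerDl.
have [e e0|v Zv vs] := Zcomplete Zs.
  have [N hN] := exp_half_small (2 * C * rn z) e0.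
  by exists N => n Nn; rewrite -(subnKC Nn) (le_lt_trans (sn' _ _)).
have c0 : 0 <= `|c| + 1 by rewrite addr_ge0.
exists v; split=> //.
- apply/eqP; rewrite -subr_eq0 -oppr_eq0 opprB; apply/eqP.
  apply: rn_eq0; apply/eqP; rewrite eq_le rn_ge0 andbT.
  apply/ler_addgt0Pr => e e0; rewrite add0r.
  have e2 : 0 < e / 2 / (`|c| + 1) by rewrite !divr_gt0// ltr_pwDr.
  have [N1 h1] := vs _ e2.
  have [N2 h2] := exp_half_small (rn z) (divr_gt0 e0 (ltr0n _ 2)).
  pose n := maxn N1 N2.
  rewrite (le_trans (rn_triangle _ (A (s n)) _))// -As -linearB /=.
  have k1 : rn (A (s n - v)) <= e / 2.
    have Zsv : Z (s n - v) by rewrite addrC -scaleN1r; exact: ZL.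
    apply: (le_trans (Ac _ Zsv)).
    have := h1 n (leq_maxl _ _); rewrite ltr_pdivlMr ?ltr_pwDr// => k.
    have cl : c <= `|c| + 1 by rewrite (le_trans (ler_norm _))// lerDl.
    by have := ler_wpM2r (p_ge0 (s n - v)) cl; lra.
  have k2 : rn (y n) <= e / 2.
    apply: (le_trans (yn n)); rewrite mulrC.
    apply/ltW/(le_lt_trans _ h2); rewrite ler_wpM2l ?rn_ge0//.
    by rewrite ler_wiXn2l ?invr_ge0 ?invf_le1 ?ler1n// leq_maxr.
  by lra.
- apply/ler_addgt0Pr => e e0.
  have [N h1] := vs _ e0.
  rewrite -(subrK (s N) v) addrC (le_trans (pD _ _))// lerD//.
    by have := sn' 0%N N; rewrite add0n {2}/s big_ord0 subr0 expr0 mulr1.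
  by rewrite -pN opprB ltW// h1.
Qed.

(** Baire's argument: were the values on each ball [p v <= m] nowhere dense in
    the range, nested balls of the range avoiding them one after the other would
    shrink to a point of the range that is no value at all. Differences of
    vectors of one such ball then solve [A v = z] up to half of [z]. *)
Lemma open_mapping (A : {linear V -> X}) (c : R) :
  (forall u : nat -> X, (forall e : R, 0 < e ->
     exists N, forall n, (N <= n)%N -> rn (u n - u N) < e) ->
   exists l, rn_cvg u l) ->
  (forall v, Z v -> rn (A v) <= c * p v) -> rn_closed (A @` Z) ->
  exists2 C : R, 0 <= C &
    forall z, (A @` Z) z -> exists v, [/\ Z v, A v = z & p v <= C * rn z].
Proof.
move=> Xcomplete Ac clA; set B := A @` Z.
have BB x y : B x -> B y -> B (x - y).
  move=> [u Zu <-] [v Zv <-]; exists (u - v); last by rewrite linearB.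
  by rewrite addrC -scaleN1r; exact: ZL.
have BZ a x : B x -> B (a *: x).
  move=> [u Zu <-]; exists (a *: u); last by rewrite linearZ.
  by rewrite -[_ *: _]addr0; exact: ZL.
pose D (m : nat) x := forall e : R, 0 < e ->
  exists2 v, Z v /\ p v <= m%:R & rn (x - A v) < e.
have [m [x0 [r [Bx0 r0 xD]]]] : exists m x0 (r : R), [/\ B x0, 0 < r &
    forall x, B x -> rn (x - x0) < r -> D m x].
  apply: contrapT => hn.
  (* The ball around [yr] of twice its radius avoids the values on [p v <= m]. *)
  have step (m : nat) (xr : X * R) : exists yr : X * R,
      B xr.1 -> 0 < xr.2 -> [/\ B yr.1, 0 < yr.2, yr.2 <= 2^-1 * xr.2,
        rn (yr.1 - xr.1) + yr.2 <= xr.2 &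
        forall v, Z v -> p v <= m%:R -> 2 * yr.2 <= rn (yr.1 - A v)].
    have [[Bx rr0]|nB] := pselect (B xr.1 /\ 0 < xr.2); last first.
      by exists xr => k1 k2; case: nB.
    have [y [By yx nD]] : exists y, [/\ B y, rn (y - xr.1) < xr.2 & ~ D m y].
      apply: contrapT => h; apply: hn; exists m, xr.1, xr.2; split=> // y By yx.
      by apply: contrapT => nD; apply: h; exists y.
    move/existsNP: nD => [e /not_implyP[e0 he]].
    exists (y, Num.min (e / 2) (Num.min (2^-1 * xr.2) (xr.2 - rn (y - xr.1)))).
    move=> _ _ /=; split => //.
    - by rewrite !lt_min; apply/and3P; split; lra.
    - by rewrite !ge_min lexx /= orbT.
    - by rewrite addrC -lerBrDr !ge_min lexx !orbT.
    - move=> v Zv vm.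
      have ev : e <= rn (y - A v).
        by rewrite leNgt; apply/negP => h; apply: he; exists v.
      apply: le_trans ev; rewrite mulrC -ler_pdivlMr//.
      by rewrite ge_min lexx.
  have [f fP] := choice (fun mx : nat * (X * R) => step mx.1 mx.2).
  pose fix u n := if n is n'.+1 then f (n', u n') else (0 : X, 1 : R).
  have B0 : B 0 by exists 0; rewrite ?linear0.
  have uP n : B (u n).1 /\ 0 < (u n).2.
    elim: n => [|n [IH1 IH2]] /=; first by split => //=; exact: ltr01.
    by have [] := fP (n, u n) IH1 IH2.
  have uS n := fP (n, u n) (uP n).1 (uP n).2.
  have ball n k : rn ((u (n + k)%N).1 - (u n).1) + (u (n + k)%N).2 <= (u n).2.
    elim: k => [|k IH]; first by rewrite addn0 subrr rn0 add0r.
    rewrite addnS /=; have [_ _ _ h _] := uS (n + k)%N.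
    have := rn_triangle (u (n + k).+1).1 (u (n + k)%N).1 (u n).1.
    by move: h IH => /=; lra.
  have small n : (u n).2 <= 1 * 2^-1 ^+ n.
    elim: n => [|n IH]; first by rewrite expr0 mulr1.
    by have [_ _ h _ _] := uS n; move: h IH => /=; rewrite exprS; lra.
  have [e e0|l ul] := Xcomplete (fun n => (u n).1).
    have [N hN] := exp_half_small 1 e0; exists N => n Nn.
    have := ball N (n - N)%N; rewrite subnKC//.
    by have := (uP n).2; have := small N; move: hN; lra.
  have lu n : rn (l - (u n).1) <= (u n).2.
    apply/ler_addgt0Pr => e e0.
    have [N hN] := ul _ e0.
    have := hN (n + N)%N (leq_addl _ _).
    have := rn_triangle l (u (n + N)%N).1 (u n).1.
    by have := ball n N; have := (uP (n + N)%N).2; rewrite (rnB l (u (n + N)%N).1) /=; lra.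
  have : B l.
    apply: clA => e e0; have [N hN] := ul _ e0.
    by exists (u N).1; [exact: (uP N).1|rewrite rnB hN].
  move=> [v Zv vl].
  have [m mv] : exists m : nat, p v <= m%:R.
    by exists (Num.truncn (p v)).+1; rewrite ltW// truncnS_gt.
  have [_ r0 _ _ /(_ v Zv mv) /=] := uS m.
  rewrite vl rnB => h1; have := lu m.+1 => /=.
  by move: h1 r0 => /=; lra.
have [C C0 h] : exists2 C : R, 0 <= C & forall z, B z -> exists v, [/\ Z v, p v <= C * rn z, B (z - A v) &
     rn (z - A v) <= 2^-1 * rn z].
  exists (4 * m%:R / r) => [|z Bz].
    by rewrite divr_ge0 ?mulr_ge0// ltW.
  have [->|/eqP z0] := eqVneq z 0.
    exists 0; rewrite linear0 subrr p0 rn0 !mulr0; split => //.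
    by exists 0; rewrite ?linear0.
  have rz := rn_gt0 z0.
  pose t : R := r / (2 * rn z).
  have t0 : 0 < t by rewrite divr_gt0// mulr_gt0.
  have tz : rn (t%:C *: z) = r / 2.
    by rewrite rnZ cabs_real ger0_norm ?ltW// /t; field; rewrite gt_eqF.
  have BxB x y : B x -> B y -> B (x + y).
    move=> Bx By; rewrite -[y]opprK -[- y]sub0r; apply: (BB _ _ Bx).
    by apply: (BB _ _ _ By); exists 0; rewrite ?linear0.
  have r8 : 0 < r / 8 by lra.
  have [|v1 [Zv1 pv1] h1] := xD (x0 + t%:C *: z) (BxB _ _ Bx0 (BZ _ _ Bz)) _ (r / 8) r8.
    by rewrite addrAC subrr add0r tz; lra.
  have [|v2 [Zv2 pv2] h2] := xD x0 Bx0 _ (r / 8) r8; first by rewrite subrr rn0.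
  have Zv : Z (v1 - v2) by rewrite addrC -scaleN1r; exact: ZL.
  have pv : p (v1 - v2) <= 2 * m%:R.
    by have := pD v1 (- v2); rewrite pN; lra.
  have hv : rn (t%:C *: z - A (v1 - v2)) <= r / 4.
    have -> : t%:C *: z - A (v1 - v2) = (x0 + t%:C *: z - A v1) - (x0 - A v2).
      by rewrite linearB /= !opprB -(addrA x0) [RHS]addrC subrKA addrCA.
    by have := rnD (x0 + t%:C *: z - A v1) (- (x0 - A v2)); rewrite rnN; lra.
  have tE : cabs (t^-1)%:C = t^-1 by rewrite cabs_real ger0_norm// invr_ge0 ltW.
  have zE : z - A ((t^-1)%:C *: (v1 - v2)) = (t^-1)%:C *: (t%:C *: z - A (v1 - v2)).
    rewrite linearZ /= scalerBr scalerA -rmorphM /= mulVf ?gt_eqF// rmorph1.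
    by rewrite scale1r.
  have tI : t^-1 = 2 * rn z / r by rewrite /t; field; rewrite !gt_eqF.
  exists ((t^-1)%:C *: (v1 - v2)); split.
  - by rewrite -[_ *: _]addr0; exact: ZL.
  - rewrite pZ tE tI -mulrA mulrC mulrA -!mulrA.
    have := ler_wpM2l (ltW (divr_gt0 (mulr_gt0 (ltr0n R 2) rz) r0)) pv.
    by congr (_ <= _); field; rewrite gt_eqF.
  - apply: BB => //; exists ((t^-1)%:C *: (v1 - v2)) => //.
    by rewrite -[_ *: _]addr0; exact: ZL.
  - rewrite zE rnZ tE.
    apply: (le_trans (ler_wpM2l (ltW (_ : 0 < t^-1)) hv)); first by rewrite invr_gt0.
    by rewrite tI le_eqVlt; apply/orP; left; apply/eqP; field; rewrite gt_eqF.
exists (2 * C) => [|z Bz]; first by rewrite mulr_ge0.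
exact: (approximate_solutions Ac C0 h).
Qed.

(** A preimage under [A] solves the equation for [A'] up to half of its
    right-hand side. *)
Lemma perturbed_surjection (A A' : {linear V -> X}) (c : R) (B : set X)
    (C d : R) :
  (forall v, Z v -> rn (A' v) <= c * p v) -> 0 <= C -> 0 <= d -> d * C <= 2^-1 ->
  (forall x y, B x -> B y -> B (x - y)) ->
  (forall v, Z v -> B (A' v)) ->
  (forall z, B z -> exists v, [/\ Z v, A v = z & p v <= C * rn z]) ->
  (forall v, Z v -> rn (A v - A' v) <= d * p v) ->
  forall z, B z -> exists v, [/\ Z v, A' v = z & p v <= 2 * C * rn z].
Proof.
move=> A'c C0 d0 dC BB BA' h AA'.
apply: (approximate_solutions A'c C0) => z Bz.
have [v [Zv Avz pv]] := h z Bz.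
exists v; split=> //; first exact/BB/BA'.
rewrite -Avz (le_trans (AA' v Zv))// (le_trans (ler_wpM2l d0 pv))// -Avz mulrA.
by rewrite ler_wpM2r// rn_ge0.
Qed.

End SuccessiveApproximation.

(** * Measure preserving maps and Borel functions *)

#[global] Instance ae_borel_filter {R : realType} {K : ptopologicalType}
  (mu : probability (borel K) R) : Filter (nbhs (almost_everywhere mu)).
Proof. exact: ae_filter_ringOfSetsType. Qed.

Section Preserving.
Context {R : realType} {K : ptopologicalType}.
Variable mu : probability (borel K) R.
Implicit Types (A E : set (borel K)) (f g : borel K -> R[i]).

Definition preserving (phi : borel K -> borel K) :=
  measurable_fun setT phi /\
  forall A, measurable A -> mu (phi @^-1` A) = mu A.

Lemma preserving_preimage phi A :
  preserving phi -> measurable A -> measurable (phi @^-1` A).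
Proof. by move=> [mphi _] mA; rewrite -[_ @^-1` _]setTI; exact: mphi. Qed.

Lemma preserving_id : preserving id.
Proof. by split. Qed.

Lemma preserving_comp phi psi :
  preserving phi -> preserving psi -> preserving (phi \o psi).
Proof.
move=> pphi ppsi; split=> [|A mA].
  by apply: measurableT_comp; [exact: pphi.1|exact: ppsi.1].
rewrite comp_preimage ppsi.2; first exact: pphi.2.
exact: preserving_preimage.
Qed.

Lemma preserving_iter phi n : preserving phi -> preserving (iter n phi).
Proof.
move=> pphi; elim: n => [|n IH]; first exact: preserving_id.
exact: preserving_comp pphi IH.
Qed.

Lemma preserving_ae phi (P : borel K -> Prop) : preserving phi ->
  (\forall k \ae mu, P k) -> \forall k \ae mu, P (phi k).
Proof.
move=> pphi [A [mA A0 PA]]; exists (phi @^-1` A); split.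
- exact: preserving_preimage.
- by rewrite pphi.2.
- by move=> k /= nP; apply: PA.
Qed.

Lemma continuous_borel (phi : K -> K) :
  continuous phi -> measurable_fun [set: borel K] (phi : borel K -> borel K).
Proof.
move=> cphi.
apply: (@measurability _ _ (borel K) (borel K) setT phi (@open K)) => //.
move=> _ [G oG <-]; rewrite setTI; apply: sub_sigma_algebra.
by move/continuousP : cphi; apply.
Qed.

Lemma measurable_cabs f : cmeasurable f -> measurable_fun setT (cabs \o f).
Proof.
move=> [mr mi]; have -> : cabs \o f =
    Num.sqrt \o (fun k => complex.Re (f k) ^+ 2 + complex.Im (f k) ^+ 2).
  by apply/funext => k /=; rewrite /cabs; case: (f k).
apply: measurableT_comp.
  by apply: continuous_measurable_fun; exact: sqrt_continuous.
by apply: measurable_funD; exact: measurable_funX.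
Qed.

Lemma cmeasurable_comp f phi : preserving phi ->
  cmeasurable f -> cmeasurable (f \o phi).
Proof.
move=> [mphi _] [mr mi]; split.
- exact: (measurableT_comp mr mphi).
- exact: (measurableT_comp mi mphi).
Qed.

Lemma cmeasurableM f g :
  cmeasurable f -> cmeasurable g -> cmeasurable (fun k => f k * g k).
Proof.
move=> [fr fi] [gr gi]; split.
- have -> : (fun k => complex.Re (f k * g k)) = (fun k =>
      complex.Re (f k) * complex.Re (g k) - complex.Im (f k) * complex.Im (g k)).
    by apply/funext => k; case: (f k) (g k) => [a b] [c d].
  by apply: measurable_funB; exact: measurable_funM.
- have -> : (fun k => complex.Im (f k * g k)) = (fun k =>
      complex.Re (f k) * complex.Im (g k) + complex.Im (f k) * complex.Re (g k)).
    by apply/funext => k; case: (f k) (g k) => [a b] [c d].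
  by apply: measurable_funD; exact: measurable_funM.
Qed.

Lemma cmeasurable_real (f : borel K -> R) :
  measurable_fun setT f -> cmeasurable (fun k => (f k)%:C).
Proof. by move=> mf; split => //=; exact: measurable_cst. Qed.

Lemma cmeasurable_indic A : measurable A -> cmeasurable (\1_A : _ -> R[i]).
Proof.
move=> mA; have -> : (\1_A : borel K -> R[i]) = fun k => (\1_A k : R)%:C.
  by apply/funext => k; rewrite !indicE; case: (_ \in _).
by apply: cmeasurable_real; exact: measurable_indic.
Qed.

Lemma cmeasurable_cst (a : R[i]) : cmeasurable (fun _ : borel K => a).
Proof. by split; exact: measurable_cst. Qed.

Lemma measurable_lt_set (f g : borel K -> R) :
  measurable_fun setT f -> measurable_fun setT g ->
  measurable [set k | f k < g k].
Proof.
move=> mf mg; rewrite -[X in measurable X]setTI.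
have := measurable_fun_ltr mf mg => /(_ measurableT [set true]).
by apply.
Qed.

Lemma negligibleP0 A : measurable A -> ~ (0 < mu A)%E ->
  \forall k \ae mu, ~ A k.
Proof.
move=> mA nA; exists A; split => //; last by move=> k /= /contrapT.
by apply/eqP; rewrite eq_le measure_ge0 andbT leNgt; apply/negP.
Qed.

End Preserving.

(** * Weighted composition operators on an ideal of functions *)

Section WeightedComposition.
Context {R : realType} {K : ptopologicalType} {mu : probability (borel K) R}.
Context {X : completeNormedModType R[i]} {rep : X -> K -> R[i]}.
Hypothesis HX : Banach_ideal mu rep.
Implicit Types (x y : X) (E F : set (borel K)) (m w : borel K -> R[i]).
Implicit Types (phi psi : borel K -> borel K) (T : X -> X).

Lemma rep_lin a x y :
  \forall k \ae mu, rep (a *: x + y) k = a * rep x k + rep y k.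
Proof. exact: (rep_linear HX). Qed.

Lemma rep0 : \forall k \ae mu, rep 0 k = 0.
Proof.
apply: filterS (rep_lin 1 0 0) => k; rewrite scaler0 addr0 mul1r => h.
by apply: (addrI (rep 0 k)); rewrite -h addr0.
Qed.

Lemma repZ a x : \forall k \ae mu, rep (a *: x) k = a * rep x k.
Proof.
by apply: filterS2 (rep_lin a x 0) rep0 => k; rewrite addr0 => -> ->; rewrite addr0.
Qed.

Lemma repD x y : \forall k \ae mu, rep (x + y) k = rep x k + rep y k.
Proof. by apply: filterS (rep_lin 1 x y) => k; rewrite scale1r mul1r. Qed.

Lemma repB x y : \forall k \ae mu, rep (x - y) k = rep x k - rep y k.
Proof.
apply: filterS (rep_lin (-1) y x) => k.
by rewrite scaleN1r mulN1r addrC => ->; rewrite addrC.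
Qed.

Lemma rep_sum n (c : nat -> R[i]) (v : nat -> X) : \forall k \ae mu,
  rep (\sum_(j < n) c j *: v j) k = \sum_(j < n) c j * rep (v j) k.
Proof.
elim: n => [|n IH].
  by apply: filterS rep0 => k h; rewrite !big_ord0.
apply: filterS3 IH (repZ (c n) (v n)) (repD (\sum_(j < n) c j *: v j) (c n *: v n)).
by move=> k h1 h2 h3; rewrite !big_ord_recr /= h3 h1 h2.
Qed.

Lemma rep_eq x y : (\forall k \ae mu, rep x k = rep y k) -> x = y.
Proof. exact: (rep_inj HX). Qed.

Lemma rn_dominated x y (c : R) : 0 <= c ->
  (\forall k \ae mu, cabs (rep x k) <= c * cabs (rep y k)) -> rn x <= c * rn y.
Proof.
move=> c0 h.
have <- : rn (c%:C *: y) = c * rn y by rewrite rnZ cabs_real ger0_norm.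
rewrite -le_rn; apply: (lattice_norm HX); apply: filterS2 h (repZ c%:C y) => k h1 ->.
by rewrite le_cabs cabsM cabs_real ger0_norm.
Qed.

Lemma rn_dominated1 x y :
  (\forall k \ae mu, cabs (rep x k) <= cabs (rep y k)) -> rn x <= rn y.
Proof.
move=> h; rewrite -[rn y]mul1r; apply: rn_dominated => //.
by apply: filterS h => k; rewrite mul1r.
Qed.

Lemma multiplication_exists m x (c : R) : cmeasurable m ->
  (\forall k \ae mu, cabs (m k) <= c) ->
  exists z, \forall k \ae mu, rep z k = m k * rep x k.
Proof.
move=> mm mc; apply: (rep_ideal HX (x := c%:C *: x)).
  exact: cmeasurableM (rep_measurable HX x).
apply: filterS2 mc (repZ c%:C x) => k h ->.
rewrite le_cabs !cabsM ler_wpM2r ?cabs_ge0// cabs_real.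
by rewrite (le_trans h)// ler_norm.
Qed.

Lemma modulus_exists x :
  exists z, \forall k \ae mu, rep z k = (cabs (rep x k))%:C.
Proof.
apply: (rep_ideal HX (x := x)); last first.
  apply/aeW => k; rewrite le_cabs cabs_real ger0_norm ?cabs_ge0//.
by apply: cmeasurable_real; apply: measurable_cabs; exact: (rep_measurable HX).
Qed.

(** Multiplications, composition operators, restrictions to Borel sets and all
    their products have this form. *)
Definition wcomp w phi T :=
  forall x, \forall k \ae mu, rep (T x) k = w k * rep x (phi k).

Lemma wcomp_linear w phi T : preserving mu phi -> wcomp w phi T -> linear T.
Proof.
move=> pphi wT a x y; apply: rep_eq.
apply: filterS3 (filterI (wT x) (wT y)) (rep_lin a (T x) (T y))
  (filterI (wT (a *: x + y)) (preserving_ae pphi (rep_lin a x y))).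
by move=> k [h1 h2] h3 [h4 h5]; rewrite h3 h4 h1 h2 h5; ring.
Qed.

Lemma wcomp_comp w w' phi phi' T T' : preserving mu phi ->
  wcomp w phi T -> wcomp w' phi' T' ->
  wcomp (fun k => w k * w' (phi k)) (phi' \o phi) (T \o T').
Proof.
move=> pphi wT wT' x.
apply: filterS2 (wT (T' x)) (preserving_ae pphi (wT' x)) => k -> -> /=.
by rewrite mulrA.
Qed.

Definition iter_weight w phi n k : R[i] := \prod_(i < n) w (iter i phi k).

Lemma wcomp_iter w phi T n : preserving mu phi -> wcomp w phi T ->
  wcomp (iter_weight w phi n) (iter n phi) (iter n T).
Proof.
move=> pphi wT; elim: n => [|n IH] x.
  by apply/aeW => k /=; rewrite /iter_weight big_ord0 mul1r.
apply: filterS (wcomp_comp pphi wT IH x) => k ->.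
rewrite /iter_weight big_ord_recl /=; congr (_ * _ * rep x _).
  by apply: eq_bigr => i _; rewrite -iterSr.
by rewrite -iterSr.
Qed.

Lemma cmeasurable_iter_weight w phi n : preserving mu phi ->
  cmeasurable w -> cmeasurable (iter_weight w phi n).
Proof.
move=> pphi mw; elim: n => [|n IH].
  have -> : iter_weight w phi 0 = cst 1.
    by apply/funext => k; rewrite /iter_weight big_ord0.
  exact: cmeasurable_cst.
have -> : iter_weight w phi n.+1 = fun k => iter_weight w phi n k * w (iter n phi k).
  by apply/funext => k; rewrite /iter_weight big_ord_recr.
apply: cmeasurableM IH _.
exact: (cmeasurable_comp (preserving_iter n pphi) mw).
Qed.

(** The default value is not taken when [E] is Borel, by [restrE]. *)
Definition restr E x : X :=
  xget 0 [set z | \forall k \ae mu, rep z k = \1_E k * rep x k].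

Lemma restrE E x : measurable E ->
  \forall k \ae mu, rep (restr E x) k = \1_E k * rep x k.
Proof.
move=> mE; rewrite /restr; case: xgetP => [z _ //|nz].
have [|z zE] := @multiplication_exists (\1_E) x 1 (cmeasurable_indic mE).
  apply/aeW => k; rewrite indicE; case: (_ \in _).
    by rewrite mulr1n cabs1.
  by rewrite mulr0n cabs0.
by have := nz z.
Qed.

Lemma wcomp_restr E : measurable E -> wcomp (\1_E) id (restr E).
Proof. by move=> mE x; exact: restrE. Qed.

Lemma restr_linear E : measurable E -> linear (restr E).
Proof. by move=> mE; exact: (wcomp_linear (preserving_id mu) (wcomp_restr mE)). Qed.

Lemma rn_restr E x : measurable E -> rn (restr E x) <= rn x.
Proof.
move=> mE; apply: rn_dominated1; apply: filterS (restrE x mE) => k ->.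
rewrite cabsM indicE; case: (_ \in _); first by rewrite mulr1n cabs1 mul1r.
by rewrite mulr0n cabs0 mul0r cabs_ge0.
Qed.

Lemma restr_restr E F x : measurable E -> measurable F ->
  restr E (restr F x) = restr (E `&` F) x.
Proof.
move=> mE mF; apply: rep_eq.
apply: filterS3 (restrE (restr F x) mE) (restrE x mF) (restrE x (measurableI _ _ mE mF)).
move=> k -> -> ->; rewrite mulrA !indicE in_setI.
by case: (_ \in E); rewrite ?mulr1n ?mulr0n ?mul1r ?mul0r.
Qed.

Lemma restr_set0 x : restr set0 x = 0.
Proof.
apply: rep_eq; apply: filterS2 (restrE x measurable0) rep0 => k -> ->.
by rewrite indicE in_set0 mul0r.
Qed.

Lemma restr_disjoint E F x : measurable E -> measurable F -> E `&` F = set0 ->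
  restr E (restr F x) = 0.
Proof. by move=> mE mF EF; rewrite restr_restr// EF restr_set0. Qed.

Lemma restr_subset E F x : measurable E -> measurable F -> E `<=` F ->
  restr F (restr E x) = restr E x.
Proof. by move=> mE mF /setIidr EF; rewrite restr_restr// EF. Qed.

Lemma restr_setC E x : measurable E -> x - restr E x = restr (~` E) x.
Proof.
move=> mE; apply: rep_eq.
apply: filterS3 (repB x (restr E x)) (restrE x mE) (restrE x (measurableC mE)).
move=> k -> -> ->; rewrite !indicE in_setC; case: (_ \in _).
  by rewrite mulr1n mulr0n mul1r mul0r subrr.
by rewrite mulr1n mulr0n mul1r mul0r subr0.
Qed.

Lemma wcomp_restr_commute w phi T E x : preserving mu phi -> measurable E ->
  wcomp w phi T -> T (restr E x) = restr (phi @^-1` E) (T x).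
Proof.
move=> pphi mE wT; apply: rep_eq.
apply: filterS3 (filterI (wT (restr E x)) (wT x)) (preserving_ae pphi (restrE x mE))
  (restrE (T x) (preserving_preimage pphi mE)).
move=> k [-> h] -> ->; rewrite h !indicE.
have -> : (k \in phi @^-1` E) = (phi k \in E) by apply/idP/idP; rewrite !inE.
by ring.
Qed.

End WeightedComposition.

Arguments wcomp {R K} mu {X} rep w phi T.
Arguments restr {R K} mu {X} rep E x.

(** * Exponential tents along orbits *)

Section Tent.
Context {R : realType}.
Implicit Types (p c : R) (N j : nat).

(** This is [p ^ |j - N|]: one of the two truncated differences is zero. *)
Definition tent p N j : R := p ^+ (N - j + (j - N))%N.

Lemma tent_gt0 p N j : 0 < p -> 0 < tent p N j.
Proof. exact: exprn_gt0. Qed.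

Lemma tent_peak p N : tent p N N = 1.
Proof. by rewrite /tent subnn expr0. Qed.

Lemma tent_step p N j : 0 < p < 1 ->
  `|tent p N j - tent p N j.+1| <= (p^-1 - 1) * tent p N j.+1.
Proof.
move=> /andP[p0 p1]; have pv : 0 < p^-1 by rewrite invr_gt0.
have pvp : p^-1 * p = 1 by rewrite mulVf ?gt_eqF.
have t0 := tent_gt0 N j.+1 p0.
have [jN|Nj] := ltnP j N.
  have E : tent p N j = p * tent p N j.+1.
    by rewrite /tent -exprS; congr (_ ^+ _); lia.
  rewrite E distrC ger0_norm; last by nra.
  have : 1 - p <= p^-1 - 1 by nra.
  by nra.
have E : tent p N j.+1 = p * tent p N j.
  by rewrite /tent -exprS; congr (_ ^+ _); lia.
rewrite E ger0_norm; last by have := tent_gt0 N j p0; nra.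
by rewrite mulrA mulrBl pvp; lra.
Qed.

Context {X : normedModType R[i]}.

(** The tent is cut off where it is low, at its two ends; inside, the coefficients
    of [T y - alpha *: y] are a small multiple of those of [y]. The hypothesis on
    [b] lets coefficients control norms, as they do when the orbit of [v]
    consists of disjoint or of nonnegative functions. *)
Lemma tent_almost_eigenvector (T : {linear X -> X}) (alpha : R[i]) p N v :
  cabs alpha = 1 -> 0 < p < 1 -> (0 < N)%N ->
  let y := \sum_(j < N.*2) (alpha^-1 ^+ j * (tent p N j)%:C) *: iter j T v in
  (forall b c, 0 <= c -> (forall j, cabs (b j) <= c * tent p N j) ->
     rn (\sum_(j < N.*2) b j *: iter j T v) <= c * rn y) ->
  rn (T y - alpha *: y) <=
    (p^-1 - 1) * rn y + p ^+ N.-1 * (rn (iter N.*2 T v) + rn v).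
Proof.
move=> a1 pp N0 y H; have /andP[p0 p1] := pp.
pose a j := alpha^-1 ^+ j * (tent p N j)%:C.
pose b j := if j is i.+1 then a i - alpha * a i.+1 else 0.
have aunit : alpha != 0 by rewrite -cabs_gt0 a1.
have ca j : cabs (a j) = tent p N j.
  rewrite /a cabsM cabsX cabsV a1 invr1 expr1n mul1r cabs_real ger0_norm//.
  exact/ltW/tent_gt0.
have [M ME] : exists M, N.*2 = M.+1 by exists N.*2.-1; lia.
have yE : y = \sum_(j < M.+1) a j *: iter j T v by rewrite /y ME.
have E : T y - alpha *: y = \sum_(j < M.+1) b j *: iter j T v +
    (a M *: iter M.+1 T v - (alpha * a 0%N) *: v).
  rewrite yE linear_sum scaler_sumr big_ord_recr /= [in X in _ - X]big_ord_recl.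
  rewrite [in RHS]big_ord_recl /= scale0r add0r linearZ /= -scalerA.
  rewrite opprD [- _ - _]addrC addrACA -sumrB scalerA; congr (_ + _).
  by apply: eq_bigr => i _; rewrite linearZ /= scalerBl !scalerA.
rewrite E; apply: (le_trans (rnD _ _)); apply: lerD.
  rewrite -ME; apply: H => [|[|j]].
  - by rewrite subr_ge0 invf_ge1// ltW.
  - have -> : b 0%N = 0 by [].
    rewrite cabs0 mulr_ge0// ?subr_ge0 ?invf_ge1//; first exact: ltW.
    exact/ltW/tent_gt0.
  - have -> : b j.+1 = alpha^-1 ^+ j * (tent p N j - tent p N j.+1)%:C.
      by rewrite /b /a exprS rmorphB /=; field.
    rewrite cabsM cabsX cabsV a1 invr1 expr1n mul1r cabs_real.
    exact: tent_step.
apply: (le_trans (rnD _ _)); rewrite rnN !rnZ cabsM a1 mul1r !ca.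
rewrite mulrDr; apply: lerD; rewrite -?ME ler_wpM2r ?rn_ge0//.
  rewrite /tent; have -> : (N - M + (M - N) = N.-1)%N by lia.
  by [].
rewrite /tent; have -> : (N - 0 + (0 - N) = N.-1.+1)%N by lia.
by rewrite ler_wiXn2l// ltW.
Qed.

End Tent.

Definition as_linear (R : realType) (X : normedModType R[i]) (T : X -> X)
  (lT : linear T) : {linear X -> X} :=
  HB.pack T (GRing.isLinear.Build R[i] X X *:%R T lT).

(** * Growth of the iterates of a composition operator *)

Section Growth.
Context {R : realType} {K : ptopologicalType} {mu : probability (borel K) R}.
Context {X : completeNormedModType R[i]} {rep : X -> K -> R[i]}.
Hypothesis HX : Banach_ideal mu rep.
Implicit Types (x y v : X).

Let nonneg x := \forall k \ae mu, rep x k = (cabs (rep x k))%:C.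

(** There is no cancellation between nonnegative functions. *)
Lemma positive_domination n (v : nat -> X) (a : nat -> R) (b : nat -> R[i]) (c : R) :
  (forall j, nonneg (v j)) -> (forall j, 0 <= a j) -> 0 <= c ->
  (forall j, cabs (b j) <= c * a j) ->
  rn (\sum_(j < n) b j *: v j) <= c * rn (\sum_(j < n) (a j)%:C *: v j).
Proof.
move=> v0 a0 c0 ba; apply: (rn_dominated HX c0).
apply: filterS3 (ae_foralln v0) (rep_sum HX n b v)
  (rep_sum HX n (fun j => (a j)%:C) v) => k h -> ->.
have -> : \sum_(j < n) (a j)%:C * rep (v j) k =
    (\sum_(j < n) a j * cabs (rep (v j) k))%:C.
  by rewrite rmorph_sum /=; apply: eq_bigr => j _; rewrite {1}h rmorphM.
rewrite cabs_real ger0_norm; last first.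
  by apply: sumr_ge0 => j _; rewrite mulr_ge0// cabs_ge0.
rewrite (le_trans (cabs_sum _ _ _))// mulr_sumr; apply: ler_sum => j _.
by rewrite cabsM mulrA ler_wpM2r// cabs_ge0.
Qed.

(** At almost every point at most one term of either sum is nonzero. *)
Lemma disjoint_domination n (v : nat -> X) (F : nat -> set (borel K))
    (a b : nat -> R[i]) (c : R) :
  (forall j, measurable (F j)) ->
  (forall i j, (i < n)%N -> (j < n)%N -> i <> j -> F i `&` F j = set0) ->
  (forall j, restr mu rep (F j) (v j) = v j) -> 0 <= c ->
  (forall j, cabs (b j) <= c * cabs (a j)) ->
  rn (\sum_(j < n) b j *: v j) <= c * rn (\sum_(j < n) a j *: v j).
Proof.
move=> mF dF vF c0 ba; apply: (rn_dominated HX c0).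
have vF0 : \forall k \ae mu, forall j, ~ F j k -> rep (v j) k = 0.
  apply: ae_foralln => j; apply: filterS (restrE HX (v j) (mF j)) => k.
  by rewrite vF => -> nF; rewrite indicE memNset// mul0r.
apply: filterS3 vF0 (rep_sum HX n b v) (rep_sum HX n a v) => k h -> ->.
have [[i Fi]|nF] := pselect (exists i : 'I_n, F i k).
  have single (d : nat -> R[i]) :
      \sum_(j < n) d j * rep (v j) k = d i * rep (v i) k.
    rewrite (bigD1 i)//= big1 ?addr0// => j ji; rewrite h ?mulr0// => Fj.
    have ij : nat_of_ord j <> i by move=> /val_inj E; rewrite E eqxx in ji.
    have : (F j `&` F i) k by [].
    by rewrite (dF j i).
  by rewrite !single !cabsM mulrA ler_wpM2r// cabs_ge0.
have zero (d : nat -> R[i]) : \sum_(j < n) d j * rep (v j) k = 0.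
  by apply: big1 => j _; rewrite h ?mulr0// => Fj; apply: nF; exists j.
by rewrite !zero cabs0 mulr0.
Qed.

Variables (phi : borel K -> borel K) (P : X -> X) (c0 : R).
Hypothesis phi_pres : preserving mu phi.
Hypothesis Pcomp : wcomp mu rep (cst 1) phi P.
Hypothesis c0_ge0 : 0 <= c0.
Hypothesis Pbound : forall x, rn (P x) <= c0 * rn x.

Let linP : linear P. Proof. exact: (wcomp_linear HX phi_pres Pcomp). Qed.

Let iterP n x : \forall k \ae mu, rep (iter n P x) k = rep x (iter n phi k).
Proof.
apply: filterS (wcomp_iter n phi_pres Pcomp x) => k ->.
by rewrite /iter_weight big1 ?mul1r.
Qed.

(** True of every [s] beyond the spectral radius of [P]. *)
Definition grows_at_most (s : R) :=
  exists2 C, 0 <= C & forall n x, rn (iter n P x) <= C * s ^+ n * rn x.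

Let iter_c0 n x : rn (iter n P x) <= c0 ^+ n * rn x.
Proof.
elim: n => [|n IH] /=; first by rewrite expr0 mul1r.
by rewrite (le_trans (Pbound _))// exprS -mulrA ler_wpM2l.
Qed.

(** If [r - P] is bounded below at a growth exponent [r], then the exponent can
    be improved: the orbit of a positive vector, weighted by a tent, would
    otherwise be an approximate eigenvector for [r]. *)
Let halved (r c : R) : 0 < r -> 0 <= c ->
  (forall x, rn x <= c * rn (r%:C *: x - P x)) ->
  (forall s, r < s -> grows_at_most s) ->
  exists2 N, (0 < N)%N & forall x, rn (iter N P x) <= 2^-1 * r ^+ N * rn x.
Proof.
move=> r0 c1 Pr Ps.
have rV : 0 < r^-1 by rewrite invr_gt0.
pose P' := as_linear linP.
have linT : linear (fun x => (r^-1)%:C *: P x).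
  move=> a x y; rewrite -[P]/(P' : X -> X) linearP scalerDr !scalerA.
  by rewrite [a * _]mulrC.
pose T := as_linear linT.
have iterT n x : iter n T x = (r^-1 ^+ n)%:C *: iter n P x.
  elim: n => [|n IH]; first by rewrite expr0 scale1r.
  rewrite /= IH -[P]/(P' : X -> X) linearZ /= scalerA exprS.
  by rewrite rmorphM.
(* With [p = 1 / (1 + d)] the tent loses a factor [c r d <= 1 / 4]; the growth
   [(1 + d / 8) ^ 2] over a doubled time is still beaten by [p]. *)
pose d := (4 * (c * r + 1))^-1.
have cr0 : 0 <= c * r by rewrite mulr_ge0// ltW.
have d0 : 0 < d by rewrite invr_gt0 mulr_gt0// ltr_wpDl.
have dE : d * (4 * (c * r + 1)) = 1 by rewrite mulVf// gt_eqF// mulr_gt0// ltr_wpDl.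
have d1 : d <= 4^-1 by nra.
have crd : c * r * d <= 4^-1 by nra.
pose p := (1 + d)^-1.
have p0 : 0 < p by rewrite invr_gt0 addr_gt0.
have pE : p * (1 + d) = 1 by rewrite mulVf// gt_eqF// addr_gt0.
have p1 : p < 1 by nra.
have pV : p^-1 - 1 = d by rewrite invrK addrC addKr.
have [C C0 growC] : grows_at_most (r * (1 + d / 8)).
  by apply: Ps; rewrite ltr_pMr// ltrDl divr_gt0.
pose th := p * (1 + d / 8) ^+ 2.
have th01 : 0 <= th < 1.
  apply/andP; split; first by rewrite mulr_ge0 ?sqr_ge0// ltW.
  have : (1 + d / 8) ^+ 2 < 1 + d by rewrite expr2; nra.
  by rewrite /th; nra.
have p01 : 0 <= p < 1 by rewrite ltW.
have e8 : 0 < 8^-1 :> R by rewrite invr_gt0.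
have [N1 hN1] := geometric_small (2 * (c * r) * p^-1 * C) th01 e8.
have [N2 hN2] := geometric_small (2 * (c * r) * p^-1) p01 e8.
pose N := (maxn N1 N2).+1.
have {hN1}hN1 := hN1 N (leqW (leq_maxl _ _)).
have {hN2}hN2 := hN2 N (leqW (leq_maxr _ _)).
exists N => // x.
have [v vx] := modulus_exists HX x.
have vpos : nonneg v.
  by apply: filterS vx => k ->; rewrite cabs_real ger0_norm ?cabs_ge0.
have Tv j : nonneg (iter j T v).
  rewrite iterT.
  apply: filterS3 (repZ HX (r^-1 ^+ j)%:C (iter j P v)) (iterP j v)
    (preserving_ae (preserving_iter j phi_pres) vpos) => k -> -> h.
  rewrite cabsM {1}h cabs_real -rmorphM ger0_norm//.
  by rewrite exprn_ge0// ltW.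
have rnv : rn v <= rn x.
  apply: (rn_dominated1 HX); apply: filterS vx => k ->.
  by rewrite cabs_real ger0_norm ?cabs_ge0.
have rnx : rn (iter N P x) <= rn (iter N P v).
  apply: (rn_dominated1 HX); apply: filterS3 (iterP N x) (iterP N v)
    (preserving_ae (preserving_iter N phi_pres) vx) => k -> -> ->.
  by rewrite cabs_real ler_norm.
have dom (b : nat -> R[i]) (e : R) : 0 <= e ->
    (forall j, cabs (b j) <= e * tent p N j) ->
    rn (\sum_(j < N.*2) b j *: iter j T v) <=
    e * rn (\sum_(j < N.*2) (1^-1 ^+ j * (tent p N j)%:C) *: iter j T v).
  move=> e0 be.
  under [X in _ <= _ * rn X]eq_bigr do rewrite invr1 expr1n mul1r.
  by apply: positive_domination => // j; exact/ltW/tent_gt0.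
have := tent_almost_eigenvector cabs1 (_ : 0 < p < 1) (isT : (0 < N)%N) dom.
rewrite p0 p1 => /(_ isT).
set y := \sum_(j < N.*2) _; rewrite scale1r => yT.
have yN : rn (iter N T v) <= rn y.
  rewrite -[rn y]mul1r.
  have := dom (fun j => (j == N)%:R) 1 ler01.
  have ltNN : (N < N.*2)%N by rewrite -addnn -[X in (X < _)%N]addn0 ltn_add2l.
  rewrite (bigD1 (Ordinal ltNN)) //= eqxx scale1r big1 ?addr0.
    apply=> j; rewrite mul1r; have [->|_] := eqVneq.
      by rewrite tent_peak cabs1.
    by rewrite cabs0 ltW// tent_gt0.
  move=> j jN; have -> : (nat_of_ord j == N) = false.
    by apply/negbTE; apply: contra jN => /eqP jN; apply/eqP/val_inj.
  by rewrite scale0r.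
have yc : rn y <= c * r * rn (T y - y).
  have := Pr y; have -> : r%:C *: y - P y = - (r%:C *: (T y - y)).
    rewrite scalerBr /= scalerA -rmorphM mulfV ?gt_eqF// scale1r opprB.
    by [].
  by rewrite rnN rnZ cabs_real (ger0_norm (ltW r0)) mulrA.
have T2 : rn (iter N.*2 T v) <= C * (1 + d / 8) ^+ N.*2 * rn x.
  have rN : 0 <= r^-1 ^+ N.*2 by rewrite exprn_ge0// ltW.
  rewrite iterT rnZ cabs_real (ger0_norm rN).
  rewrite (le_trans (ler_wpM2l rN (growC _ _)))// exprMn.
  have -> : r^-1 ^+ N.*2 * (C * (r ^+ N.*2 * (1 + d / 8) ^+ N.*2) * rn v) =
      C * (1 + d / 8) ^+ N.*2 * rn v.
    by rewrite exprVn; field; rewrite expf_neq0// gt_eqF.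
  by rewrite ler_wpM2l// mulr_ge0// exprn_ge0// addr_ge0// divr_ge0// ltW.
have pN : p ^+ N.-1 = p^-1 * p ^+ N.
  by rewrite /= exprS mulKf// gt_eqF.
have thN : th ^+ N = p ^+ N * (1 + d / 8) ^+ N.*2.
  by rewrite /th exprMn -exprM mul2n.
have rx := rn_ge0 x.
have key : rn y <= 2^-1 * rn x.
  have h1 : rn (T y - y) <= d * rn y + p^-1 * (C * th ^+ N + p ^+ N) * rn x.
    apply: (le_trans yT); rewrite pV lerD2l thN pN.
    have pp : 0 <= p^-1 * p ^+ N.
      by apply: mulr_ge0; [rewrite invr_ge0|apply: exprn_ge0]; exact: ltW.
    rewrite (le_trans (ler_wpM2l pp (lerD T2 rnv)))//.
    by rewrite le_eqVlt; apply/orP; left; apply/eqP; ring.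
  have h2 := le_trans yc (ler_wpM2l cr0 h1).
  have h3 : c * r * d * rn y <= 4^-1 * rn y by rewrite ler_wpM2r ?rn_ge0.
  have h4 : 2 * (c * r) * p^-1 * (C * th ^+ N + p ^+ N) * rn x <= 4^-1 * rn x.
    by rewrite ler_wpM2r//; lra.
  by lra.
have rN : 0 <= r^-1 ^+ N by rewrite exprn_ge0// ltW.
have := le_trans yN key; rewrite iterT rnZ cabs_real (ger0_norm rN).
rewrite exprVn mulrC ler_pdivrMr ?exprn_gt0// => h.
by rewrite (le_trans rnx)// (le_trans h)// -mulrA [r ^+ N * _]mulrC mulrA.
Qed.

Let bernoulli (t : R) n : 0 <= t <= 1 -> 1 - n%:R * t <= (1 - t) ^+ n.
Proof.
move=> /andP[t0 t1]; elim: n => [|n IH]; first by rewrite mul0r subr0 expr0.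
have t10 : 0 <= 1 - t by rewrite subr_ge0.
rewrite exprS; apply: le_trans (ler_wpM2l t10 IH); rewrite -natr1.
have : 0 <= n%:R * t * t by rewrite !mulr_ge0.
by lra.
Qed.

Let grows_from_power (q : R) N : 0 < q -> (0 < N)%N ->
  (forall x, rn (iter N P x) <= q ^+ N * rn x) -> grows_at_most q.
Proof.
move=> q0 N0 h; have cq : 0 <= c0 / q by rewrite divr_ge0// ltW.
exists (\sum_(b < N) (c0 / q) ^+ b).
  by apply: sumr_ge0 => b _; exact: exprn_ge0.
move=> n; elim/ltn_ind: n => n IH x.
have [nN|Nn] := ltnP n N.
  apply: (le_trans (iter_c0 n x)); rewrite ler_wpM2r ?rn_ge0//.
  have -> : c0 ^+ n = (c0 / q) ^+ n * q ^+ n.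
    by rewrite -exprMn divfK// gt_eqF.
  rewrite ler_wpM2r//; first exact/exprn_ge0/ltW.
  rewrite (bigD1 (Ordinal nN))//= lerDl.
  by apply: sumr_ge0 => b _; exact: exprn_ge0.
rewrite -{1}(subnKC Nn) iterD (le_trans (h _))//.
have qN : 0 <= q ^+ N by rewrite exprn_ge0// ltW.
have nN : (n - N < n)%N by lia.
rewrite (le_trans (ler_wpM2l qN (IH _ nN x)))//.
by rewrite -{2}(subnKC Nn) exprD le_eqVlt; apply/orP; left; apply/eqP; ring.
Qed.

Let grows_le (s t : R) : 0 <= s -> s <= t -> grows_at_most s -> grows_at_most t.
Proof.
move=> s0 st [C C0 h]; exists C => // n x; apply: (le_trans (h n x)).
by rewrite ler_wpM2r ?rn_ge0// ler_wpM2l// lerXn2r// nnegrE// (le_trans s0).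
Qed.

(** Were it larger than 1, the infimum of the growth exponents would be an
    approximate eigenvalue of the positive operator [P]. So bounds from below at
    the points of a half line control all iterates. *)
Lemma spectral_growth :
  (forall s, 1 < s -> exists2 c, 0 <= c &
     forall x, rn x <= c * rn (s%:C *: x - P x)) ->
  forall s, 1 < s -> grows_at_most s.
Proof.
move=> Pbelow s s1.
pose S := [set t : R | 0 < t /\ grows_at_most t].
have S0 : has_lbound S by exists 0 => t [t0 _]; exact: ltW.
have SI : has_inf S.
  split=> //; exists (c0 + 1); split; first by rewrite ltr_wpDl.
  exists 1 => // n x; rewrite mul1r (le_trans (iter_c0 n x))//.
  by rewrite ler_wpM2r ?rn_ge0// lerXn2r ?nnegrE ?addr_ge0// lerDl.
have above t : inf S < t -> grows_at_most t.
  move=> /(inf_lt SI.1)[u [u0 gu] ut].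
  by apply: grows_le gu; exact: ltW.
have [r1|r1] := ltP 1 (inf S); last by apply: above; exact: le_lt_trans s1.
have r0 : 0 < inf S by lra.
have [c c1 hc] := Pbelow _ r1.
have [N N0 hN] := halved r0 c1 hc above.
have NR : 0 < N%:R :> R by rewrite ltr0n.
have N1 : 1 <= N%:R :> R by rewrite ler1n.
pose t : R := (2 * N%:R)^-1.
(* [(1 - t) ^ N >= 1 / 2], so [inf S * (1 - t)] is again a growth exponent. *)
have tN : N%:R * t = 2^-1 by rewrite /t; field; rewrite gt_eqF.
have t0 : 0 < t by rewrite invr_gt0 mulr_gt0.
have t01 : 0 <= t <= 1 by apply/andP; split; nra.
have q0 : 0 < inf S * (1 - t) by rewrite mulr_gt0//; nra.
have : S (inf S * (1 - t)).
  split=> //; apply: (grows_from_power q0 N0) => x.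
  rewrite (le_trans (hN x))// ler_wpM2r ?rn_ge0// exprMn mulrC.
  rewrite ler_wpM2l ?exprn_ge0 ?(ltW r0)//.
  by have := bernoulli N t01; rewrite tN; lra.
by move=> /(ge_inf S0); nra.
Qed.

End Growth.

(** * Small sets with disjoint translates *)

Section Wandering.
Context {R : realType} {K : ptopologicalType}.
Variables (mu : probability (borel K) R) (phi : K -> K).
Hypothesis K_hausdorff : hausdorff_space K.
Hypothesis phi_continuous : continuous phi.
Hypothesis phi_pres : preserving mu (phi : borel K -> borel K).
Hypothesis mu_regular : regular_measure mu.
Hypothesis mu_periodic : mu (periodic_points phi) = 0%E.
Implicit Types (E F : set (borel K)) (k : K).

Definition wandering (M : nat) E := forall d k,
  (0 < d <= M)%N -> E k -> ~ E (iter d phi k).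

Lemma wanderingS M E F : E `<=` F -> wandering M F -> wandering M E.
Proof. by move=> EF wF d k dM Ek /EF; exact/(wF d k dM)/EF. Qed.

Lemma wandering_disjoint M E i j : wandering M E -> i <> j ->
  (i <= M)%N -> (j <= M)%N ->
  (iter i phi @^-1` E) `&` (iter j phi @^-1` E) = set0.
Proof.
move=> wE; wlog ij : i j / (i < j)%N => [H nij iM jM|_ iM jM].
  have [h|h|//] := ltngtP i j; first exact: H.
  by rewrite setIC; apply: H => // E'; apply: nij.
apply/seteqP; split=> // k [/= Ei Ej].
apply: (wE (j - i)%N _ _ Ei); first by lia.
by rewrite -iterD subnK// ltnW.
Qed.

Let iter_continuous n : continuous (iter n phi).
Proof.
elim: n => [|n IH] k /=; first exact: cvg_id.
by apply: continuous_comp; [exact: IH|exact: phi_continuous].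
Qed.

Let open_preimage n (G : set K) : open G -> open (iter n phi @^-1` G).
Proof. by move=> oG; apply: open_comp => // k _; exact: iter_continuous. Qed.

Let separate k d : iter d phi k <> k -> exists G : set K,
  [/\ open G, G k & forall x, G x -> ~ G (iter d phi x)].
Proof.
move=> /eqP dk; rewrite eq_sym in dk.
move: K_hausdorff; rewrite open_hausdorff => /(_ _ _ dk)[[A B] /= [Ak Bk]].
move=> [oA oB /eqP AB]; rewrite !inE in Ak Bk.
exists (A `&` (iter d phi @^-1` B)); split=> //.
  by apply: openI => //; exact: open_preimage.
move=> x [_ /= Bx] [Ax _]; suff : (A `&` B) (iter d phi x) by rewrite AB.
by [].
Qed.

(** Separate [k] from its first [M] images. *)
Lemma aperiodic_wandering k M : ~ periodic_points phi k ->
  exists G : set K, [/\ open G, G k & wandering M G].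
Proof.
move=> nk; elim: M => [|M [G [oG Gk wG]]].
  by exists setT; split=> //; [exact: openT|move=> d x; lia].
have [|H [oH Hk wH]] := @separate k M.+1.
  by move=> E; apply: nk; exists M.+1.
exists (G `&` H); split=> //; first exact: openI.
move=> d x /andP[d0]; rewrite leq_eqVlt => /orP[/eqP ->|dM] [Gx Hx] [Gy Hy].
  exact: wH Hx Hy.
by apply: (wG d x _ Gx Gy); rewrite d0.
Qed.

Let measurable_open (G : set K) : open G -> measurable (G : set (borel K)).
Proof. by move=> oG; exact: sub_sigma_algebra. Qed.

Lemma measurable_periodic_points :
  measurable (periodic_points phi : set (borel K)).
Proof.
have -> : periodic_points phi =
    \bigcup_(n in [set: nat]) (~` [set k | iter n.+1 phi k <> k]).
  apply/seteqP; split=> k.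
    move=> [[|n] [n0 E]]; first by [].
    by exists n => //= h; apply: h.
  by move=> [n _ /= /contrapT E]; exists n.+1.
apply: bigcupT_measurable => n; apply: measurableC; apply: measurable_open.
rewrite openE => k /separate[G [oG Gk hG]].
apply: (filterS _ (open_nbhs_nbhs (conj oG Gk))) => x Gx E.
by apply: (hG x Gx); rewrite E.
Qed.

Let borel_compact (C : set K) : compact C -> measurable (C : set (borel K)).
Proof.
move=> cC; rewrite -[C]setCK; apply: measurableC; apply: measurable_open.
by apply: closed_openC; exact: compact_closed.
Qed.

(** By inner regularity, [E] contains a compact set of nonperiodic points of
    positive measure; finitely many wandering open sets cover it, and one of
    them meets it in positive measure. *)
Lemma positive_wandering_subset E M : measurable E -> (0 < mu E)%E ->
  exists F, [/\ measurable F, F `<=` E, (0 < mu F)%E & wandering M F].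
Proof.
move=> mE E0; have mP := measurable_periodic_points.
have mEP : measurable (E `\` periodic_points phi) by exact: measurableD.
have EP : mu (E `\` periodic_points phi) = mu E.
  have PE0 : mu (E `&` periodic_points phi) = 0%E.
    apply/eqP; rewrite eq_le measure_ge0 andbT -mu_periodic.
    by apply: le_measure; rewrite ?inE//; exact: measurableI.
  have -> : mu E = (mu (E `\` periodic_points phi) +
      mu (E `&` periodic_points phi))%E by exact: measureDI.
  by rewrite PE0 adde0.
move: E0; rewrite -EP (mu_regular mEP).1 => /ereal_sup_gt[_ [C [cC CE] <-] C0].
have mC := borel_compact cC.
have wit k : exists G : set K, C k -> [/\ open G, G k & wandering M G].
  have [Ck|nC] := pselect (C k); last by exists setT.
  have [G hG] := @aperiodic_wandering k M (CE k Ck).2.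
  by exists G.
have [G hG] := choice wit.
have := cC; rewrite compact_cover => /(_ K C G).
have oG i : C i -> open (G i) by move=> /hG[].
move=> /(_ oG)[|D DC CD].
  by move=> k Ck; exists k => //; have [] := hG k Ck.
apply: contrapT => hn.
suff : (mu C <= 0)%E by rewrite leNgt C0.
have neg k : C k -> mu.-negligible (C `&` G k : set (borel K)).
  move=> Ck; have [ok _ wk] := hG k Ck.
  have mCG : measurable (C `&` G k : set (borel K)).
    by apply: measurableI => //; exact: measurable_open.
  apply/negligibleP => //; apply/eqP; rewrite eq_le measure_ge0 andbT leNgt.
  apply/negP => CG0; apply: hn; exists (C `&` G k); split=> //.
    by move=> x [/CE[]].
  by apply: wanderingS wk => x [].
suff /(measure_negligible mC) -> : mu.-negligible (C : set (borel K)) by [].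
have : mu.-negligible (\big[setU/set0]_(k <- finmap.enum_fset D) (C `&` G k) : set (borel K)).
  rewrite big_seq; elim/big_ind : _ => [|A B|k /DC].
  - exact: negligible_set0.
  - exact: negligibleU.
  - by rewrite inE; exact: neg.
apply: negligibleS => x Cx; have [k /= kD Gx] := CD x Cx.
by rewrite (big_rem k)//=; left.
Qed.

(** Many disjoint translates of equal measure share a total mass of 1. *)
Lemma small_positive_subset E (e : R) : measurable E -> (0 < mu E)%E -> 0 < e ->
  exists F, [/\ measurable F, F `<=` E, (0 < mu F)%E & (mu F < e%:E)%E].
Proof.
move=> mE E0 e0.
pose M := Num.truncn e^-1.
have Me : e^-1 < M.+1%:R by exact: truncnS_gt.
have [F [mF FE F0 wF]] := positive_wandering_subset M mE E0.
exists F; split=> //; rewrite ltNge; apply/negP => eF.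
pose G j : set (borel K) := if (j <= M)%N then iter j phi @^-1` F else set0.
have mG j : measurable (G j).
  rewrite /G; case: ifP => // _.
  exact: (preserving_preimage (preserving_iter j phi_pres)).
have tG : trivIset setT G.
  apply/trivIsetP => i j _ _ /eqP ij; rewrite /G.
  case: ifP => iM; last by rewrite set0I.
  case: ifP => jM; last by rewrite setI0.
  exact: wandering_disjoint wF ij iM jM.
have := measure_bigsetU mu mG tG M.+1.
have muG1 : (mu (\big[setU/set0]_(i < M.+1) G i) <= 1)%E.
  by apply: probability_le1; exact: bigsetU_measurable.
move=> EF; move: muG1; rewrite EF leNgt => /negP; apply.
apply: (@lt_le_trans _ _ (\sum_(i < M.+1) e%:E)%E).
  rewrite sumEFin sumr_const card_ord lte_fin -mulr_natl -ltr_pdivrMr//.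
  by rewrite div1r.
apply: lee_sum => i _; have iM : (i <= M)%N by rewrite -ltnS.
rewrite /G iM; apply: (le_trans eF).
by have <- := (preserving_iter i phi_pres).2 F mF.
Qed.

(** A set of positive measure is not an atom, hence splits at will. *)
Lemma split_positive n E : measurable E -> (0 < mu E)%E ->
  exists F : nat -> set (borel K),
    (forall i, (i < n)%N -> [/\ measurable (F i), F i `<=` E & (0 < mu (F i))%E]) /\
    (forall i j, (i < n)%N -> (j < n)%N -> i <> j -> F i `&` F j = set0).
Proof.
elim: n E => [|n IH] E mE E0; first by exists (fun _ => set0).
have Efin : mu E \is a fin_num by exact: fin_num_measure.
have E0' : 0 < fine (mu E) by rewrite fine_gt0// E0 ltey_eq Efin.
have [A [mA AE A0 AltE]] := small_positive_subset mE E0 E0'.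
have B0 : (0 < mu (E `\` A))%E.
  have EA : E `&` A = A by exact/setIidr.
  have h : mu E = (mu (E `\` A) + mu (E `&` A))%E by exact: measureDI.
  rewrite EA in h.
  rewrite lt0e measure_ge0 andbT; apply/eqP => h0.
  by move: AltE; rewrite fineK// h h0 add0e ltxx.
have [F [hF dF]] := IH _ (measurableD mE mA) B0.
exists (fun i => if i is j.+1 then F j else A); split=> [[|i] /= iN|].
- by split.
- by have [? FE ?] := hF i iN; split=> // x /FE[].
have AF i : (i < n)%N -> A `&` F i = set0.
  move=> iN; have [_ FE _] := hF i iN.
  by apply/seteqP; split=> // x [Ax /FE[]].
move=> [|i] [|j] iN jN ij //=; first exact: AF.
  by rewrite setIC; exact: AF.
by apply: dF => // E'; apply: ij; rewrite E'.
Qed.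

End Wandering.

(** * Localized approximate eigenvectors *)

Section Localization.
Context {R : realType} {K : ptopologicalType} {mu : probability (borel K) R}.
Context {X : completeNormedModType R[i]} {rep : X -> K -> R[i]}.
Hypothesis HX : Banach_ideal mu rep.
Variables (phi psi : borel K -> borel K) (U V : X -> X).
Hypotheses (phi_pres : preserving mu phi) (psi_pres : preserving mu psi).
Hypotheses (phiK : cancel phi psi) (psiK : cancel psi phi).
Hypotheses (Ucomp : wcomp mu rep (cst 1) phi U).
Hypotheses (Vcomp : wcomp mu rep (cst 1) psi V).
Hypotheses (growU : forall s : R, 1 < s -> grows_at_most U s).
Hypotheses (growV : forall s : R, 1 < s -> grows_at_most V s).
Implicit Types (x y u : X) (E F D : set (borel K)) (Y : set X).

Lemma composition_inverse : cancel U V.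
Proof.
move=> x; apply: (rep_eq HX).
apply: filterS2 (Vcomp (U x)) (preserving_ae psi_pres (Ucomp x)) => k -> ->.
by rewrite /= !mul1r psiK.
Qed.

Let iterUV N : cancel (iter N U) (iter N V).
Proof.
elim: N => // N IH x; rewrite iterSr /=.
by rewrite composition_inverse; exact: IH.
Qed.

Let iter_phiK N : cancel (iter N phi) (iter N psi).
Proof. by elim: N => // N IH x; rewrite iterSr /= phiK; exact: IH. Qed.

Let iterU N x : \forall k \ae mu, rep (iter N U x) k = rep x (iter N phi k).
Proof.
apply: filterS (wcomp_iter N phi_pres Ucomp x) => k ->.
by rewrite /iter_weight big1 ?mul1r.
Qed.

Lemma shift_bounds (s : R) : 1 < s -> exists2 C : R, 0 < C & forall N x,
  rn x <= C * s ^+ N * rn (iter N U x) /\ rn (iter N U x) <= C * s ^+ N * rn x.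
Proof.
move=> s1; have [C1 C10 h1] := growU s1; have [C2 C20 h2] := growV s1.
exists (C1 + C2 + 1) => [|N x]; first by lra.
have sN : 0 <= s ^+ N by rewrite exprn_ge0//; lra.
have bd (C t : R) : 0 <= C -> C <= C1 + C2 + 1 -> 0 <= t ->
    C * s ^+ N * t <= (C1 + C2 + 1) * s ^+ N * t.
  by move=> C0 CC t0; rewrite ler_wpM2r// ler_wpM2r.
split; last by apply: le_trans (h1 N x) _; apply: bd; rewrite ?rn_ge0//; lra.
rewrite -{1}(iterUV N x); apply: le_trans (h2 N _) _.
by apply: bd; rewrite ?rn_ge0//; lra.
Qed.

Section Weighted.
Variables (w : borel K -> R[i]) (T : X -> X) (cT : R).
Hypotheses (wT : wcomp mu rep w phi T) (mw : cmeasurable w).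
Hypotheses (cT0 : 0 <= cT) (Tbound : forall x, rn (T x) <= cT * rn x).

Let linT : linear T. Proof. exact: (wcomp_linear HX phi_pres wT). Qed.
Let TL := as_linear linT.

Let wN N := iter_weight w phi N.

Let iterT N x : \forall k \ae mu,
  rep (iter N T x) k = wN N k * rep x (iter N phi k).
Proof. exact: wcomp_iter. Qed.

(** Along the [N] steps that start at [k] the weights multiply to at least
    [q ^ N], and along the [N] steps that lead to [k] to at most [q ^ -N]. *)
Definition balanced N (q : R) : set (borel K) :=
  [set k | q ^+ N <= cabs (wN N k) /\ cabs (wN N (iter N psi k)) <= q^-1 ^+ N].

Let mwN N : measurable_fun setT (cabs \o wN N).
Proof.
exact: (measurable_cabs (cmeasurable_iter_weight N phi_pres mw)).
Qed.

Let mwNpsi N : measurable_fun setT (cabs \o (wN N \o iter N psi)).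
Proof.
have m := cmeasurable_iter_weight N phi_pres mw.
exact: (measurable_cabs (cmeasurable_comp (preserving_iter N psi_pres) m)).
Qed.

Lemma measurable_balanced N q : measurable (balanced N q).
Proof.
have -> : balanced N q =
    (~` [set k | cabs (wN N k) < q ^+ N]) `&`
    (~` [set k | q^-1 ^+ N < cabs (wN N (iter N psi k))]).
  apply/seteqP; split=> k /=.
    by move=> [h1 h2]; split; apply/negP; rewrite -leNgt.
  by move=> [/negP + /negP]; rewrite -!leNgt.
apply: measurableI; apply: measurableC.
  exact: (measurable_lt_set (mwN N) (measurable_cst _)).
exact: (measurable_lt_set (measurable_cst _) (mwNpsi N)).
Qed.

(** Iterates of an approximate fixed vector do not decay forward and do not
    grow backward; as the shifts grow subexponentially, this forces the weights
    to be balanced somewhere. *)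
Lemma balanced_positive (q : R) : 0 < q < 1 ->
  (forall e : R, 0 < e -> exists2 x, rn x = 1 & rn (T x - x) < e) ->
  exists N0, forall N, (N0 <= N)%N -> (0 < mu (balanced N q))%E.
Proof.
move=> /andP[q0 q1] approx.
have iter_approx N : exists2 D : R, 0 <= D &
    forall x, rn (iter N T x - x) <= D * rn (T x - x).
  elim: N => [|N [D D0 IH]].
    by exists 0 => // x; rewrite subrr rn0 mul0r.
  exists (cT * D + 1) => [|x]; first by rewrite addr_ge0// mulr_ge0.
  apply: (le_trans (rn_triangle _ (T x) _)); rewrite mulrDl mul1r lerD2r /=.
  have -> : T (iter N T x) - T x = T (iter N T x - x).
    by rewrite -[T]/(TL : X -> X) linearB.
  by rewrite (le_trans (Tbound _))// -mulrA ler_wpM2l.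
pose s := (1 + q^-1) / 2.
have qV : q * q^-1 = 1 by rewrite mulfV// gt_eqF.
have qV1 : 1 < q^-1 by rewrite invf_gt1.
have s1 : 1 < s by rewrite /s; lra.
have qs : 0 <= q * s < 1 by apply/andP; split; rewrite /s; nra.
have [C C0 hC] := shift_bounds s1.
have e4 : 0 < 4^-1 :> R by rewrite invr_gt0.
have [N0 hN0] := geometric_small C qs e4.
exists N0 => N /hN0; rewrite exprMn => small.
rewrite ltNge; apply/negP => neg.
have bad : \forall k \ae mu, ~ balanced N q k.
  by apply: negligibleP0; [exact: measurable_balanced|rewrite ltNge neg].
have [D D0 hD] := iter_approx N.
have [x x1 Tx] := approx (4^-1 / (D + 1)) (divr_gt0 e4 (ltr_wpDl D0 ltr01)).
have TNx : rn (iter N T x - x) <= 4^-1.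
  apply: (le_trans (hD x)); rewrite -[leRHS]mulr1.
  have := Tx; rewrite ltr_pdivlMr ?ltr_wpDl// => h.
  by have := rn_ge0 (T x - x); lra.
(* On [A] the vector [iter N T x], hence [x], is small; on [B] the vector [x] is
   small since [iter N T x] is bounded. *)
pose A : set (borel K) := [set k | cabs (wN N k) < q ^+ N].
pose B : set (borel K) := [set k | q^-1 ^+ N < cabs (wN N (iter N psi k))].
have mA : measurable A.
  exact: (measurable_lt_set (mwN N) (measurable_cst _)).
have mB : measurable B.
  exact: (measurable_lt_set (measurable_cst _) (mwNpsi N)).
have qN : 0 < q ^+ N by exact: exprn_gt0.
have xAB : rn x <= rn (restr mu rep A x) + rn (restr mu rep B x).
  have := rn_triangle x (restr mu rep A x) 0; rewrite !subr0 addrC.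
  move/le_trans; apply; rewrite lerD2l (restr_setC HX _ mA).
  apply: (rn_dominated1 HX).
  apply: filterS3 bad (restrE HX x (measurableC mA)) (restrE HX x mB).
  move=> k nk -> ->; rewrite !cabsM ler_wpM2r ?cabs_ge0// !indicE.
  case: (boolP (k \in B)) => [_|/negP nB].
    rewrite mulr1n cabs1; case: (_ \in _); first by rewrite mulr1n cabs1.
    by rewrite mulr0n cabs0.
  case: (boolP (k \in ~` A)) => [|_]; last by rewrite !mulr0n cabs0.
  rewrite inE /= => /negP; rewrite -leNgt => h1.
  exfalso; apply: nk; split=> //.
  by rewrite leNgt; apply/negP => h2; apply: nB; rewrite inE.
have hA : rn (restr mu rep A x) <= 4^-1 + C * s ^+ N * q ^+ N.
  have linA := restr_linear HX mA; pose RA := as_linear linA.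
  have -> : restr mu rep A x = restr mu rep A (x - iter N T x) +
      restr mu rep A (iter N T x).
    by rewrite -[restr mu rep A]/(RA : X -> X) linearB subrK.
  apply: rnD2.
    by rewrite (le_trans (rn_restr HX _ mA))// rnB.
  have : rn (restr mu rep A (iter N T x)) <= q ^+ N * rn (iter N U x).
    apply: (rn_dominated HX) (ltW qN) _.
    apply: filterS3 (restrE HX (iter N T x) mA) (iterT N x) (iterU N x).
    move=> k -> -> ->; rewrite !cabsM mulrA ler_wpM2r ?cabs_ge0// indicE.
    case: (boolP (k \in A)) => [|_]; last by rewrite mulr0n cabs0 mul0r ltW.
    by rewrite inE mulr1n cabs1 mul1r => /ltW.
  move/le_trans; apply; rewrite mulrC ler_wpM2r ?(ltW qN)//.
  by have [_] := hC N x; rewrite x1 mulr1.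
have hB : rn (restr mu rep B x) <= C * s ^+ N * q ^+ N * (1 + 4^-1).
  have [h _] := hC N (restr mu rep B x).
  have s0 : 0 <= s ^+ N by rewrite exprn_ge0//; lra.
  have Cs : 0 <= C * s ^+ N by rewrite mulr_ge0// ltW.
  rewrite (le_trans h)// -!mulrA ler_wpM2l ?(ltW C0)// ler_wpM2l//.
  have : rn (iter N U (restr mu rep B x)) <= q ^+ N * rn (iter N T x).
    apply: (rn_dominated HX) (ltW qN) _.
    apply: filterS3 (iterU N (restr mu rep B x)) (iterT N x)
      (preserving_ae (preserving_iter N phi_pres) (restrE HX x mB)).
    move=> k -> -> ->; rewrite !cabsM mulrA ler_wpM2r ?cabs_ge0// indicE.
    case: (boolP (_ \in B)) => [|_]; last first.
      by rewrite mulr0n cabs0 mulr_ge0 ?cabs_ge0// ltW.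
    rewrite mulr1n cabs1 inE /B /= iter_phiK exprVn => /ltW.
    by rewrite -div1r ler_pdivrMr// mulrC.
  move/le_trans; apply; rewrite ler_wpM2l ?(ltW qN)//.
  by have := rn_le_sub (iter N T x) x; rewrite x1; lra.
have Cq0 : 0 <= C * s ^+ N * q ^+ N.
  by rewrite !mulr_ge0 ?exprn_ge0//; lra.
move: small; rewrite -[q ^+ N * _]mulrC mulrA => small.
by lra.
Qed.

Definition tent_vector (alpha : R[i]) (p : R) N u : X :=
  \sum_(j < N.*2) (alpha^-1 ^+ j * (tent p N j)%:C) *: iter j T u.

Definition orbit_set N E : set (borel K) :=
  \bigcup_(j in `I_N.*2) (iter j phi @^-1` E).

Lemma measurable_orbit_set N E : measurable E -> measurable (orbit_set N E).
Proof.
move=> mE; apply: bigcup_measurable => j _.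
exact: (preserving_preimage (preserving_iter j phi_pres)).
Qed.

Let iterT_restr j E u : measurable E ->
  iter j T (restr mu rep E u) = restr mu rep (iter j phi @^-1` E) (iter j T u).
Proof.
move=> mE.
exact: (wcomp_restr_commute HX u (preserving_iter j phi_pres) mE
  (wcomp_iter j phi_pres wT)).
Qed.

(** On vectors carried by a wandering set [E] of balanced points, the middle of
    the orbit dominates both ends, and the tent construction succeeds. *)
Lemma tent_vector_estimate (alpha : R[i]) (eta : R) : cabs alpha = 1 -> 0 < eta ->
  (forall e : R, 0 < e -> exists2 x, rn x = 1 & rn (T x - x) < e) ->
  exists p N F, [/\ (0 < N)%N, measurable F, (0 < mu F)%E &
    exists2 kappa : R, 0 < kappa & forall E u, measurable E -> E `<=` F ->
      wandering phi N.*2 E -> restr mu rep E u = u ->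
      let y := tent_vector alpha p N u in
      [/\ rn (T y - alpha *: y) <= eta * rn y, rn u <= kappa * rn y &
          restr mu rep (orbit_set N E) y = y] ].
Proof.
move=> a1 eta0 approx.
(* [d <= 1] gives [(1 + d) ^ 3 - 1 <= 7 d <= eta / 2]. *)
pose d := Num.min 1 (eta / 14).
have d0 : 0 < d by rewrite lt_min ltr01 divr_gt0.
have d1 : d <= 1 by rewrite ge_min lexx.
have d14 : 14 * d <= eta.
  have : d <= eta / 14 by rewrite ge_min lexx orbT.
  by lra.
pose q := (1 + d)^-1.
have q0 : 0 < q by rewrite invr_gt0; lra.
have qE : q * (1 + d) = 1 by rewrite mulVf// gt_eqF//; lra.
have q1 : q < 1 by nra.
have q01 : 0 < q < 1 by rewrite q0.
have [N0 hN0] := balanced_positive q01 approx.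
pose s := (1 + q^-1) / 2.
have qVE : q^-1 = 1 + d by rewrite invrK.
have s1 : 1 < s by rewrite /s qVE; lra.
have qs : 0 <= q * s < 1 by apply/andP; split; rewrite /s qVE; nra.
have [C C0 hC] := shift_bounds s1.
(* The ratio is a cube so that [p ^ N] beats the bound [C s ^ N q ^ -N] by which
   the ends of the orbit may exceed its middle. *)
pose p := q ^+ 3.
have p0 : 0 < p by rewrite exprn_gt0.
have p1 : p < 1 by rewrite /p exprn_ilt1// ltW.
have pV : p^-1 - 1 <= eta / 2.
  rewrite /p -exprVn qVE !exprS expr0.
  have : d * d <= d by nra.
  have : d * d * d <= d by nra.
  by nra.
have e8 : 0 < eta / 4 by rewrite divr_gt0.
have [N1 hN1] := geometric_small (C * p^-1) qs e8.
pose N := (maxn N0 N1).+1.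
have {}hN0 := hN0 N (leqW (leq_maxl _ _)).
have {}hN1 := hN1 N (leqW (leq_maxr _ _)).
have pN := preserving_iter N psi_pres.
exists p, N, (iter N psi @^-1` (balanced N q)); split=> //.
- exact: (preserving_preimage pN (measurable_balanced N q)).
- by rewrite (pN.2 _ (measurable_balanced N q)).
pose G := C * s ^+ N * q^-1 ^+ N.
have qN : 0 < q ^+ N by exact: exprn_gt0.
have qVN : 0 < q^-1 ^+ N by rewrite exprn_gt0// invr_gt0.
have sN : 0 < s ^+ N by rewrite exprn_gt0//; lra.
have G0 : 0 < G by rewrite !mulr_gt0.
exists G => // E u mE EF wE uE y.
pose v := iter N T u.
have carried : \forall k \ae mu, iter N phi k \in E \/ rep u (iter N phi k) = 0.
  have := restrE HX u mE; rewrite uE => h.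
  apply: filterS (preserving_ae (preserving_iter N phi_pres) h) => k ->.
  rewrite indicE; case: (_ \in _); first by left.
  by right; rewrite mulr0n mul0r.
have uv : rn u <= G * rn v.
  have [h _] := hC N u; apply: (le_trans h).
  rewrite /G -[leRHS]mulrA ler_wpM2l ?mulr_ge0 ?(ltW C0) ?(ltW sN)//.
  apply: (rn_dominated HX) (ltW qVN) _.
  apply: filterS3 carried (iterU N u) (iterT N u) => k [/[!inE] Ek|u0] -> ->.
    rewrite cabsM mulrA ler_peMl ?cabs_ge0//.
    have [+ _] := EF _ Ek; rewrite iter_phiK => h1.
    by rewrite exprVn -ler_pdivrMl ?invr_gt0// invrK mulr1.
  by rewrite u0 mulr0 cabs0 mulr0.
have v2 : rn (iter N.*2 T u) <= G * rn v.
  have -> : iter N.*2 T u = iter N T v by rewrite -addnn iterD.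
  have [_ h] := hC N v.
  rewrite /G -mulrA [_ * rn v]mulrC mulrA.
  rewrite (le_trans _ (ler_wpM2r (ltW qVN) h))// [leRHS]mulrC.
  apply: (rn_dominated HX) (ltW qVN) _.
  apply: filterS3 (filterI (iterU N v) (iterT N v))
    (preserving_ae (preserving_iter N phi_pres) carried)
    (preserving_ae (preserving_iter N phi_pres) (iterT N u)).
  move=> k [-> ->] c ->; rewrite !cabsM.
  case: c => [/[!inE] Ek|u0]; last by rewrite u0 cabs0 !mulr0.
  apply: ler_wpM2r; first by rewrite mulr_ge0 ?cabs_ge0.
  by have [_ +] := EF _ Ek; rewrite !iter_phiK.
have mEj j : measurable (iter j phi @^-1` E).
  exact: (preserving_preimage (preserving_iter j phi_pres)).
have Tu j : restr mu rep (iter j phi @^-1` E) (iter j T u) = iter j T u.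
  by rewrite -iterT_restr// uE.
have ca j : cabs (alpha^-1 ^+ j * (tent p N j)%:C) = tent p N j.
  rewrite cabsM cabsX cabsV a1 invr1 expr1n mul1r cabs_real ger0_norm//.
  exact/ltW/tent_gt0.
have dom (b : nat -> R[i]) (e : R) : 0 <= e ->
    (forall j, cabs (b j) <= e * tent p N j) ->
    rn (\sum_(j < N.*2) b j *: iter j T u) <= e * rn y.
  move=> e0 be.
  apply: (disjoint_domination HX (v := fun j => iter j T u)
    (a := fun j => alpha^-1 ^+ j * (tent p N j)%:C) mEj _ Tu e0) => [i j|j].
    by move=> /ltnW iN /ltnW jN ij; exact: wandering_disjoint wE ij iN jN.
  by rewrite ca.
have vy : rn v <= rn y.
  rewrite -[rn y]mul1r.
  have := dom (fun j => (j == N)%:R) 1 ler01.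
  have ltNN : (N < N.*2)%N by rewrite -addnn -[X in (X < _)%N]addn0 ltn_add2l.
  rewrite (bigD1 (Ordinal ltNN)) //= eqxx scale1r big1 ?addr0.
    apply=> j; rewrite mul1r; have [->|_] := eqVneq.
      by rewrite tent_peak cabs1.
    by rewrite cabs0 ltW// tent_gt0.
  move=> j jN; have -> : (nat_of_ord j == N) = false.
    by apply/negbTE; apply: contra jN => /eqP jN; apply/eqP/val_inj.
  by rewrite scale0r.
split.
- have p01 : 0 < p < 1 by rewrite p0.
  have key : rn (T y - alpha *: y) <=
      (p^-1 - 1) * rn y + p ^+ N.-1 * (rn (iter N.*2 T u) + rn u).
    exact: (@tent_almost_eigenvector _ _ TL alpha p N u a1 p01 isT dom).
  apply: (le_trans key).
  have pN1 : p ^+ N.-1 = p^-1 * p ^+ N by rewrite /= exprS mulKf// gt_eqF.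
  have gq : p ^+ N * G <= C * (q * s) ^+ N.
    have -> : p ^+ N * G = C * (q * s) ^+ N * q ^+ N.
      have -> : p ^+ N = q ^+ N * q ^+ N * q ^+ N.
        by rewrite /p -!exprMn !exprS expr0 mulr1 mulrA.
      have qq : q ^+ N * q^-1 ^+ N = 1 by rewrite -exprMn mulfV ?expr1n// gt_eqF.
      rewrite /G [(q * s) ^+ N]exprMn; move: qq; move: (q ^+ N) (q^-1 ^+ N) (s ^+ N) => x y' z h.
      by rewrite -[RHS]mulr1 -h; ring.
    rewrite ler_piMr ?mulr_ge0 ?exprn_ge0 ?(ltW C0)//; first by case/andP: qs.
    by rewrite exprn_ile1 ?(ltW q0)// ltW.
  have pNN : 0 <= p ^+ N.-1 by rewrite exprn_ge0// ltW.
  have h1 : p ^+ N.-1 * (rn (iter N.*2 T u) + rn u) <= eta / 2 * rn y.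
    apply: (le_trans (ler_wpM2l pNN (lerD v2 uv))).
    have pVG : p^-1 * (p ^+ N * G) <= eta / 4.
      apply/ltW/(le_lt_trans _ hN1); rewrite [C * _]mulrC -mulrA.
      by rewrite ler_wpM2l// invr_ge0 ltW.
    have -> : p ^+ N.-1 * (G * rn v + G * rn v) = 2 * (p^-1 * (p ^+ N * G)) * rn v.
      by rewrite pN1; ring.
    have := ler_wpM2r (rn_ge0 v) pVG.
    have : eta / 4 * rn v <= eta / 4 * rn y by rewrite ler_wpM2l// ltW.
    by lra.
  have h2 : (p^-1 - 1) * rn y <= eta / 2 * rn y by rewrite ler_wpM2r// rn_ge0.
  by rewrite [eta in leRHS]splitr [leRHS]mulrDl; exact: lerD.
- by apply: (le_trans uv); rewrite ler_wpM2l// ltW.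
- have mO := measurable_orbit_set N mE.
  pose RO := as_linear (restr_linear HX mO).
  rewrite -[restr mu rep _]/(RO : X -> X) linear_sum; apply: eq_bigr => j _.
  rewrite linearZ /=; congr (_ *: _).
  rewrite -{1}(Tu j) (restr_subset HX) ?Tu//.
  by move=> k Ek; exists j => //=.
Qed.

(** The tent construction is continuous, so it may start from a vector of [Y]
    that is only almost carried by [E]; multiplications would lead out of [Y],
    but iterates of [T] do not. *)
Lemma localized_eigenvectors Y (alpha : R[i]) (eta : R) :
  linear_subspace Y -> T @` Y `<=` Y ->
  (forall E, measurable E -> (0 < mu E)%E -> forall e : R, 0 < e ->
    exists u, [/\ Y u, rn u = 1 & rn (u - restr mu rep E u) < e]) ->
  cabs alpha = 1 -> 0 < eta ->
  (forall e : R, 0 < e -> exists2 x, rn x = 1 & rn (T x - x) < e) ->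
  exists N F, [/\ measurable F, (0 < mu F)%E &
    forall E, measurable E -> E `<=` F -> (0 < mu E)%E ->
      wandering phi N.*2 E ->
      exists y, [/\ Y y, rn y = 1, rn (T y - alpha *: y) <= eta &
        rn (y - restr mu rep (orbit_set N E) y) <= eta] ].
Proof.
move=> [Y0 YL] TY Yloc a1 eta0 approx.
have eta2 : 0 < eta / 2 by rewrite divr_gt0.
have [p [N [F [N0 mF F0 [ka ka0 hE]]]]] := tent_vector_estimate a1 eta2 approx.
exists N, F; split=> // E mE EF E0 wE.
pose a j := alpha^-1 ^+ j * (tent p N j)%:C.
have linI j : linear (iter j T).
  exact: (wcomp_linear HX (preserving_iter j phi_pres) (wcomp_iter j phi_pres wT)).
have linQ : linear (tent_vector alpha p N).
  move=> b x y; rewrite /tent_vector scaler_sumr -big_split /=.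
  apply: eq_bigr => j _; rewrite linI scalerDr !scalerA; congr (_ *: _ + _).
  by rewrite mulrC.
pose Q := as_linear linQ.
have [H H0 QH] : exists2 H : R, 0 <= H & forall u, rn (Q u) <= H * rn u.
  exists (\sum_(j < N.*2) cabs (a j) * cT ^+ j).
    by apply: sumr_ge0 => j _; rewrite mulr_ge0 ?cabs_ge0// exprn_ge0.
  move=> u; rewrite (le_trans (rn_sum _ _ _))// mulr_suml; apply: ler_sum => j _.
  rewrite rnZ -mulrA ler_wpM2l ?cabs_ge0//.
  elim: (nat_of_ord j) => [|i IH]; first by rewrite expr0 mul1r.
  by rewrite (le_trans (Tbound _))// exprS -mulrA ler_wpM2l.
have YT j u : Y u -> Y (iter j T u).
  by move=> Yu; elim: j => //= j IH; apply: TY; exists (iter j T u).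
have YQ u : Y u -> Y (Q u).
  move=> Yu; rewrite /Q /= /tent_vector.
  elim/big_ind : _ => // [x y Yx Yy|j _]; first by rewrite -[x]scale1r; exact: YL.
  by rewrite -[_ *: _]addr0; apply: YL => //; exact: YT.
(* The error [e] of the localization of [u] is multiplied by at most [M], to be
   compared with [rn (Q u)], which is at least of the order of [1 / ka]. *)
pose M := (eta + cT + 1) * H.
have M0 : 0 <= M by rewrite mulr_ge0// !addr_ge0// ltW.
pose e := Num.min (1 / 2) (eta / (4 * ka * (M + 1))).
have e0 : 0 < e by rewrite lt_min !divr_gt0// !mulr_gt0// ltr_wpDl.
have [u [Yu u1 ue]] := Yloc E mE E0 e e0.
have e12 : e <= 1 / 2 by rewrite ge_min lexx.
have Me : M * e * (4 * ka) <= eta.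
  have : e * (4 * ka * (M + 1)) <= eta.
    by rewrite -ler_pdivlMr ?mulr_gt0 ?ltr_wpDl// ge_min lexx orbT.
  have : 0 <= e * (4 * ka) by rewrite !mulr_ge0// ltW.
  have -> : e * (4 * ka * (M + 1)) = M * e * (4 * ka) + e * (4 * ka) by ring.
  by move=> h h'; apply: le_trans h'; rewrite lerDl.
pose u' := restr mu rep E u.
have u'E : restr mu rep E u' = u' by rewrite /u' (restr_restr HX)// setIid.
have [/= h1 h2 h3] := hE E u' mE EF wE u'E.
rewrite -/(Q u') in h1 h2 h3.
have dQ : rn (Q u - Q u') <= H * e.
  by rewrite -linearB (le_trans (QH _))// ler_wpM2l// ltW.
have u'1 : 1 / 2 <= rn u' by have := rn_le_sub u u'; rewrite u1; lra.
have y'1 : 1 / 2 <= ka * rn (Q u') by exact: le_trans u'1 h2.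
have He0 : 0 <= H * e by rewrite mulr_ge0// ltW.
have Qu' : rn (Q u') <= rn (Q u) + H * e.
  by have := rn_le_sub (Q u') (Q u); rewrite rnB; lra.
have big : M * e <= eta / 2 * rn (Q u').
  rewrite -(ler_pM2r (_ : 0 < 4 * ka)) ?mulr_gt0//.
  by have := ler_wpM2l (ltW eta0) y'1; lra.
have big2 : (eta / 2 + cT + 1) * (H * e) <= eta / 2 * rn (Q u).
  have := ler_wpM2l (ltW eta2) Qu'; move: big; rewrite /M.
  by lra.
have cHe : 0 <= cT * (H * e) by rewrite mulr_ge0.
have eHe : 0 <= eta / 2 * (H * e) by rewrite mulr_ge0// ltW.
have y0 : 0 < rn (Q u).
  rewrite lt_neqAle rn_ge0 andbT; apply/eqP => E1.
  have He : H * e <= 0 by move: big2; rewrite -E1; lra.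
  have Q'0 : rn (Q u') <= 0 by lra.
  have := ler_wpM2l (ltW ka0) Q'0; lra.
have est1 : rn (T (Q u) - alpha *: Q u) <= eta * rn (Q u).
  have -> : T (Q u) - alpha *: Q u = (T (Q u') - alpha *: Q u') +
      (T (Q u - Q u') - alpha *: (Q u - Q u')).
    rewrite -[T]/(TL : X -> X) linearB scalerBr /=.
    by rewrite opprB addrACA [T (Q u') + _]addrC subrK addKr.
  have h4 : rn (T (Q u - Q u') - alpha *: (Q u - Q u')) <= (cT + 1) * (H * e).
    rewrite mulrDl mul1r; apply: rnD2.
      by rewrite (le_trans (Tbound _))// ler_wpM2l.
    by rewrite rnN rnZ a1 mul1r.
  apply: (le_trans (rnD2 h1 h4)).
  have := ler_wpM2l (ltW eta2) Qu'; move: big2; lra.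
have mO := measurable_orbit_set N mE.
pose RO := as_linear (restr_linear HX mO).
have est2 : rn (Q u - restr mu rep (orbit_set N E) (Q u)) <= eta * rn (Q u).
  have linC := restr_linear HX (measurableC mO).
  pose RC := as_linear linC.
  have RC0 : RC (Q u') = 0 by rewrite /RC /= -(restr_setC HX)// h3 subrr.
  rewrite (restr_setC HX)// -[restr mu rep _]/(RC : X -> X).
  have -> : RC (Q u) = RC (Q u - Q u') by rewrite linearB RC0 subr0.
  rewrite (le_trans (rn_restr HX _ (measurableC mO)))// (le_trans dQ)//.
  by have := ltW (mulr_gt0 eta2 y0); lra.
pose t := (rn (Q u))^-1.
have t0 : 0 < t by rewrite invr_gt0.
have ct : cabs t%:C = t by rewrite cabs_real ger0_norm// ltW.
have tQ : t * rn (Q u) = 1 by rewrite mulVf// gt_eqF.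
exists (t%:C *: Q u); split.
- by rewrite -[_ *: _]addr0; apply: YL => //; exact: YQ.
- by rewrite rnZ ct.
- have -> : T (t%:C *: Q u) - alpha *: (t%:C *: Q u) =
      t%:C *: (T (Q u) - alpha *: Q u).
    by rewrite -[T]/(TL : X -> X) linearZ scalerBr /= !scalerA [alpha * _]mulrC.
  rewrite rnZ ct; have := ler_wpM2l (ltW t0) est1.
  by rewrite mulrCA tQ mulr1.
- rewrite -[restr mu rep _]/(RO : X -> X) linearZ -scalerBr /= rnZ ct.
  have := ler_wpM2l (ltW t0) est2.
  by rewrite mulrCA tQ mulr1.
Qed.

End Weighted.

End Localization.

(** * Semi-Fredholm operators with robust approximate kernels *)

Lemma linear_dependence (F : fieldType) (n m : nat) (A : 'I_n -> 'I_m -> F) :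
  (m < n)%N -> exists a : 'I_n -> F,
    (exists i, a i <> 0) /\ forall j, \sum_i a i * A i j = 0.
Proof.
move=> mn; pose M := \matrix_(i, j) A i j.
have kM : kermx M != 0.
  rewrite kermx_eq0 /row_free neq_ltn; apply/orP; left.
  exact: leq_ltn_trans (rank_leq_col M) mn.
have nz : nz_row (kermx M) != 0 by rewrite nz_row_eq0.
exists (fun i => nz_row (kermx M) 0 i); split.
  apply: contrapT => h; move/eqP: nz; apply; apply/rowP => i; rewrite mxE.
  by apply: contrapT => hi; apply: h; exists i.
move=> j; have /sub_kermxP/rowP/(_ j) : (nz_row (kermx M) <= kermx M)%MS.
  exact: nz_row_sub.
by rewrite !mxE => E; rewrite -[RHS]E; apply: eq_bigr => i _; rewrite mxE.
Qed.

Lemma cabs_complete (R : realType) (u : nat -> R[i]) :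
  (forall e : R, 0 < e ->
     exists N, forall n, (N <= n)%N -> cabs (u n - u N) < e) ->
  exists l, forall e : R, 0 < e ->
     exists N, forall n, (N <= n)%N -> cabs (u n - l) < e.
Proof.
move=> h.
have real_complete (v : nat -> R) : (forall n m, `|v n - v m| <= cabs (u n - u m)) ->
    exists l, forall e : R, 0 < e -> exists N, forall n, (N <= n)%N -> `|v n - l| < e.
  move=> vu; have /cvg_ex[l vl] : cvg (v @ \oo).
    apply: cauchy_cvg; apply: cauchy_exP => e /h[N hN].
    exists (v N), N => // n /= Nn.
    by rewrite -ball_normE /= distrC (le_lt_trans (vu _ _))// hN.
  exists l => e e0; move/cvgrPdist_lt : vl => /(_ e e0)[N _ hN].
  by exists N => n Nn; rewrite distrC; exact: hN.
have normRe (z : R[i]) : `|complex.Re z| <= cabs z.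
  by have := normc_ge_Re z; rewrite normC_cabs lecR.
have normIm (z : R[i]) : `|complex.Im z| <= cabs z.
  have := normRe (z * 'i%C); rewrite ReiNIm normrN cabsM.
  have -> : cabs ('i%C : R[i]) = 1.
    by rewrite /cabs /= expr0n /= add0r expr1n sqrtr1.
  by rewrite mulr1.
have [|a ha] := real_complete (fun n => complex.Re (u n)).
  move=> n m; have := normRe (u n - u m).
  by case: (u n) (u m) => ? ? [? ?].
have [|b hb] := real_complete (fun n => complex.Im (u n)).
  move=> n m; have := normIm (u n - u m).
  by case: (u n) (u m) => ? ? [? ?].
exists (a +i* b) => e e0.
have e2 : 0 < e / 2 by rewrite divr_gt0.
have [N1 h1] := ha _ e2; have [N2 h2] := hb _ e2.
exists (maxn N1 N2) => n; rewrite geq_max => /andP[n1 n2].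
have {}h1 := h1 n n1; have {}h2 := h2 n n2.
have E (z z' : R[i]) : z - z' =
    (complex.Re z - complex.Re z')%:C + (complex.Im z - complex.Im z')%:C * 'i%C.
  case: z z' => x y [x' y']; apply/eqP.
  by rewrite eq_complex /= !(mul0r, mulr0, mulr1, add0r, addr0, subr0) !eqxx.
rewrite E (le_lt_trans (cabsD _ _))// cabsM !cabs_real.
have -> : cabs ('i%C : R[i]) = 1.
  by rewrite /cabs /= expr0n /= add0r expr1n sqrtr1.
by rewrite mulr1; lra.
Qed.

Section Fredholm.
Context {R : realType} {X : completeNormedModType R[i]}.
Implicit Types (Y : set X) (S T : {linear X -> X}).

Lemma closed_rn (V : set X) : rn_closed V -> closed V.
Proof.
move=> cV x xV; apply: cV => e e0.
have [|y [Vy xy]] := xV (ball x e%:C).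
  by apply: nbhsx_ballx; rewrite ltcR.
by exists y => //; move: xy; rewrite -ball_normE /= rnE ltcR.
Qed.

Lemma subspace_complete Y : closed Y -> forall u : nat -> X,
  (forall n, Y (u n)) ->
  (forall e : R, 0 < e ->
     exists N, forall n, (N <= n)%N -> rn (u n - u N) < e) ->
  exists2 l, Y l & rn_cvg u l.
Proof.
move=> cY u Yu /rn_complete[l ul]; exists l => //.
apply: (rn_closedP cY) => e /ul[N hN].
by exists (u N); rewrite // rnB hN.
Qed.

(** Approximate kernels of any finite dimension, whose independence withstands
    a perturbation of fixed size. *)
Definition robust_kernel Y (S : X -> X) := forall n, exists2 theta : R, 0 < theta &
  forall eta : R, 0 < eta -> exists y : 'I_n -> X,
    (forall i, [/\ Y (y i), rn (y i) = 1 & rn (S (y i)) <= eta]) /\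
    forall z : 'I_n -> X, (forall i, rn (y i - z i) <= theta) ->
      forall c : 'I_n -> R[i], \sum_i c i *: z i = 0 -> forall i, c i = 0.

Lemma robust_not_Phi_plus Y S (c : R) : linear_subspace Y -> closed Y ->
  (forall x, rn (S x) <= c * rn x) -> robust_kernel Y S -> ~ Phi_plus_on Y S.
Proof.
move=> [Y0 YL] cY Sc rob [/rn_closedP clR [m [e [_ kerE]]]].
have [C C0 hC] := open_mapping (@rn_ge0 _ _) (@rnD _ _) (@rnZ _ _) Y0 YL
  (subspace_complete cY) (@rn_complete _ X) (fun v _ => Sc v) clR.
have [th th0 hth] := rob m.+1.
have [|y [Yy indep]] := hth (th / (C + 1)); first by rewrite divr_gt0// ltr_wpDl.
have /choice[v hv] : forall i : 'I_m.+1, exists v, [/\ Y v, S v = S (y i) & rn v <= th].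
  move=> i; have [Yi _ Si] := Yy i.
  have [|v [Yv Sv vC]] := hC (S (y i)); first by exists (y i).
  exists v; split=> //; apply: (le_trans vC).
  have := ler_wpM2l C0 Si; move/le_trans; apply.
  rewrite mulrCA ler_piMr ?(ltW th0)// ler_pdivrMr ?mul1r ?lerDl// ltr_wpDl//.
have ker i : ker_on Y S (y i - v i).
  have [Yv Sv _] := hv i; split; last by rewrite linearB Sv subrr.
  by rewrite addrC -scaleN1r; apply: YL => //; have [] := Yy i.
have /choice[A hA] : forall i, exists a : 'I_m -> R[i], y i - v i = \sum_j a j *: e j.
  by move=> i; have := ker i; rewrite kerE => -[a _ <-]; exists a.
have [a [[i ai] aA]] := linear_dependence A (ltnSn m).
apply: ai; apply: (indep (fun i => y i - v i)) => [k|].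
  by rewrite subKr; have [] := hv k.
under eq_bigr do rewrite hA scaler_sumr.
rewrite exchange_big big1// => j _.
under eq_bigr do rewrite scalerA.
by rewrite -scaler_suml aA scale0r.
Qed.

(** The range stays of finite codimension and the kernel nonzero near [lam]:
    adding finitely many directions makes [lam - T] onto, which is stable, while
    the dimension of the approximate kernel exceeds the number of directions. *)
Lemma robust_codim_eigenvalues Y T (c : R) (lam : R[i]) :
  linear_subspace Y -> closed Y -> (forall x, Y x -> Y (T x)) ->
  (forall x, rn (T x) <= c * rn x) -> 0 <= c ->
  robust_kernel Y (fun x => lam *: x - T x) ->
  finite_codim_range Y (fun x => lam *: x - T x) ->
  exists2 t : R, 0 < t & forall lam', cabs (lam' - lam) < t ->
    exists x, [/\ Y x, x <> 0 & T x = lam' *: x].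
Proof.
move=> [Y0 YL] cY TY Tc c0 rob [m [e [Ye _ span]]].
(* The vectors [e j] span a complement of the range. *)
pose V := (X * 'rV[R[i]]_m)%type.
pose p (v : V) : R := rn v.1 + \sum_j cabs (v.2 0 j).
pose Z : set V := [set v | Y v.1].
have p_ge0 v : 0 <= p v.
  by rewrite addr_ge0 ?rn_ge0//; apply: sumr_ge0 => j _; exact: cabs_ge0.
have pD (u v : V) : p (u + v) <= p u + p v.
  rewrite /p addrACA lerD ?rnD// -big_split /=; apply: ler_sum => j _.
  by rewrite mxE cabsD.
have pZ a (v : V) : p (a *: v) = cabs a * p v.
  rewrite /p mulrDr rnZ mulr_sumr; congr (_ + _).
  by apply: eq_bigr => j _; rewrite mxE cabsM.
have Z0 : Z 0 by [].
have ZL a (u v : V) : Z u -> Z v -> Z (a *: u + v) by exact: YL.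
have cabs_le_p j (v : V) : cabs (v.2 0 j) <= p v.
  rewrite /p (bigD1 j)//= addrCA lerDl addr_ge0 ?rn_ge0//.
  by apply: sumr_ge0 => i _; exact: cabs_ge0.
have rn_le_p (v : V) : rn v.1 <= p v.
  by rewrite lerDl; apply: sumr_ge0 => j _; exact: cabs_ge0.
have Zc (u : nat -> V) : (forall n, Z (u n)) ->
    (forall e : R, 0 < e ->
       exists N, forall n, (N <= n)%N -> p (u n - u N) < e) ->
    exists2 l, Z l & forall e : R, 0 < e ->
       exists N, forall n, (N <= n)%N -> p (u n - l) < e.
  move=> Zu cu.
  have [d d0|x Yx xu] := subspace_complete cY Zu.
    have [N hN] := cu _ d0; exists N => n /hN; exact: le_lt_trans (rn_le_p _).
  have /choice[a ha] : forall j : 'I_m, exists a : R[i], forall d : R, 0 < d ->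
      exists N, forall n, (N <= n)%N -> cabs ((u n).2 0 j - a) < d.
    move=> j; apply: cabs_complete => d /cu[N hN]; exists N => n /hN.
    by apply: le_lt_trans; have := cabs_le_p j (u n - u N); rewrite !mxE.
  exists (x, \row_j a j) => // d d0.
  have dm : 0 < d / m.+1%:R by rewrite divr_gt0.
  have [N1 h1] := xu _ dm.
  have /choice[N2 h2] : forall j : 'I_m, exists N, forall n, (N <= n)%N ->
      cabs ((u n).2 0 j - a j) < d / m.+1%:R by move=> j; exact: ha.
  exists (maxn N1 (\max_j N2 j)) => n; rewrite geq_max => /andP[n1 n2].
  have le2 : \sum_j cabs ((u n - (x, \row_j a j)).2 0 j) <=
      \sum_(j < m) d / m.+1%:R.
    apply: ler_sum => j _; rewrite !mxE ltW// h2//.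
    exact: leq_trans (leq_bigmax j) n2.
  rewrite /p (lt_le_trans (ltr_leD (h1 n n1) le2))//.
  rewrite sumr_const card_ord -[_ *+ m]mulr_natl le_eqVlt; apply/orP; left.
  by apply/eqP; rewrite -natr1; field; rewrite natr1 pnatr_eq0.
have linA l : linear (fun v : V => l *: v.1 - T v.1 + \sum_j v.2 0 j *: e j).
  move=> a u v /=; rewrite linearP scalerDr scalerA mulrC -scalerA.
  have -> : \sum_j (a *: u + v).2 0 j *: e j =
      a *: (\sum_j u.2 0 j *: e j) + \sum_j v.2 0 j *: e j.
    rewrite scaler_sumr -big_split; apply: eq_bigr => j _ /=.
    by rewrite !mxE scalerDl scalerA.
  rewrite [in RHS]scalerDr [RHS]addrACA; congr (_ + _).
  by rewrite opprD addrACA scalerBr.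
pose A l : {linear V -> X} :=
  HB.pack (fun v : V => l *: v.1 - T v.1 + \sum_j v.2 0 j *: e j)
    (GRing.isLinear.Build _ _ _ _ _ (linA l)).
have Ae l v : rn (A l v) <= (cabs l + c + \sum_j rn (e j)) * p v.
  rewrite mulrDl; apply: rnD2.
    apply: (le_trans (_ : _ <= (cabs l + c) * rn v.1)).
      rewrite mulrDl; apply: rnD2; first by rewrite rnZ.
      by rewrite rnN.
    by rewrite ler_wpM2l// addr_ge0// cabs_ge0.
  rewrite (le_trans (rn_sum _ _ _))// mulr_suml; apply: ler_sum => j _.
  by rewrite rnZ mulrC ler_wpM2l ?rn_ge0.
have AY l v : Z v -> Y (A l v).
  have YD x y : Y x -> Y y -> Y (x + y).
    by move=> Yx Yy; rewrite -[x]scale1r; exact: YL.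
  have YZ a x : Y x -> Y (a *: x).
    by move=> Yx; rewrite -[_ *: _]addr0; exact: YL.
  move=> Zv; apply: (YD); first apply: (YD); first exact: YZ.
    by rewrite -scaleN1r; apply: YZ; exact: TY.
  by elim/big_ind : _ => // j _; exact: YZ.
have onto : A lam @` Z = Y.
  apply/seteqP; split=> [_ [v Zv <-]|x Yx]; first exact: AY.
  have [a [y Yy yx]] := span x Yx.
  exists (y, \row_j a j) => //=.
  under eq_bigr do rewrite mxE.
  by rewrite yx subrK.
have clA : rn_closed (A lam @` Z) by rewrite onto; exact: rn_closedP.
have [C C0 hC] := open_mapping p_ge0 pD pZ Z0 ZL Zc (@rn_complete _ X)
  (fun v _ => Ae lam v) clA.
rewrite onto in hC.
have [th th0 hth] := rob m.+1.
exists (Num.min (2 * (C + 1))^-1 (th / (4 * (C + 1)))) => [|lam'].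
  by rewrite lt_min invr_gt0 divr_gt0// mulr_gt0// ltr_wpDl.
have C1 : 0 < C + 1 by rewrite ltr_wpDl.
rewrite lt_min => /andP[d1 d2].
set d := cabs (lam' - lam) in d1 d2.
have d0 : 0 <= d by exact: cabs_ge0.
have dC : d * C <= 2^-1.
  have : d * (2 * (C + 1)) <= 1 by rewrite -ler_pdivlMr ?mulr_gt0// div1r ltW.
  by lra.
have dth : d * (4 * (C + 1)) <= th by rewrite -ler_pdivlMr ?mulr_gt0// ltW.
have YB x y : Y x -> Y y -> Y (x - y).
  by move=> Yx Yy; rewrite addrC -scaleN1r; exact: YL.
have AA' v : Z v -> rn (A lam v - A lam' v) <= d * p v.
  move=> _; have -> : A lam v - A lam' v = - ((lam' - lam) *: v.1).
    rewrite /A /= opprD addrACA subrr addr0 opprB addrA subrK.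
    by rewrite scalerBl opprB.
  by rewrite rnN rnZ ler_wpM2l.
have sol := perturbed_surjection p_ge0 pD pZ Z0 ZL Zc (fun v _ => Ae lam' v)
  C0 d0 dC YB (AY lam') hC AA'.
have [|y [Yy indep]] := hth (th / (4 * (C + 1))).
  by rewrite divr_gt0// mulr_gt0.
have /choice[v hv] : forall i, exists v,
    [/\ Z v, A lam' v = lam' *: y i - T (y i) & rn v.1 <= th].
  move=> i; have [Yi y1 Si] := Yy i.
  have YS : Y (lam' *: y i - T (y i)).
    by apply: YB; [rewrite -[_ *: _]addr0; exact: YL|exact: TY].
  have [v [Zv Av pv]] := sol _ YS; exists v; split=> //.
  apply: (le_trans (rn_le_p v)); apply: (le_trans pv).
  have : rn (lam' *: y i - T (y i)) <= d + th / (4 * (C + 1)).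
    have -> : lam' *: y i - T (y i) =
        (lam' - lam) *: y i + (lam *: y i - T (y i)).
      by rewrite scalerBl addrA subrK.
    by apply: rnD2 => //; rewrite rnZ y1 mulr1.
  have thC : th / (4 * (C + 1)) * (4 * (C + 1)) = th.
    by rewrite divfK// gt_eqF// mulr_gt0.
  set r := rn _; set q := th / _ in thC * => rq.
  have : 2 * C * r <= 2 * C * (d + q) by rewrite ler_wpM2l// mulr_ge0.
  have : 0 <= q by rewrite /q divr_ge0 ?mulr_ge0 ?(ltW th0) ?(ltW C1).
  by lra.
pose a := fun i j => (v i).2 0 j.
(* One relation between the [m.+1] coefficient rows removes all the [e j]. *)
have [b [[i bi] ba]] := linear_dependence a (ltnSn m).
pose x := \sum_i b i *: (y i - (v i).1).
have Yx : Y x.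
  rewrite /x; elim/big_ind : _ => // [u u' Yu Yu'|k _].
    by rewrite -[u]scale1r; exact: YL.
  rewrite -[_ *: _]addr0; apply: YL => //.
  by apply: YB; [have [] := Yy k|have [] := hv k].
exists x; split=> //.
  move=> x0; apply: bi; apply: (indep (fun k => y k - (v k).1)) x0 i => k.
  by rewrite subKr; have [] := hv k.
apply/eqP; rewrite eq_sym -subr_eq0; apply/eqP.
have E k : lam' *: (y k - (v k).1) - T (y k - (v k).1) = \sum_j a k j *: e j.
  have [_ Av _] := hv k.
  have -> : \sum_j a k j *: e j =
      (lam' *: y k - T (y k)) - (lam' *: (v k).1 - T (v k).1).
    by rewrite -Av /A /= addrAC subrr add0r.
  rewrite (linearB T) scalerBr !opprB addrACA [RHS]addrACA; congr (_ + _).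
  by rewrite addrC.
rewrite /x scaler_sumr linear_sum -sumrB.
have Eb k : lam' *: (b k *: (y k - (v k).1)) - T (b k *: (y k - (v k).1)) =
    \sum_j b k *: (a k j *: e j).
  by rewrite [T _]linearZ scalerA mulrC -scalerA -scalerBr E scaler_sumr.
under eq_bigr do rewrite Eb.
rewrite exchange_big big1// => j _.
under eq_bigr do rewrite scalerA.
by rewrite -scaler_suml ba scale0r.
Qed.

End Fredholm.

(** * Logarithmic integrals and moduli of eigenvalues *)

Section LogIntegral.
Context {R : realType} {K : ptopologicalType}.
Variables (mu : probability (borel K) R) (phi : borel K -> borel K).
Hypothesis phi_pres : preserving mu phi.
Implicit Types (h : borel K -> \bar R) (f g : borel K -> R[i]).

Let log f (k : borel K) : \bar R := lne (cabs (f k))%:E.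

Lemma measurable_log f : cmeasurable f -> measurable_fun setT (log f).
Proof.
move=> mf; apply: measurable_fun_ifT.
- by apply: measurable_fun_ler; [exact: measurable_cabs|exact: measurable_cst].
- exact: measurable_cst.
- apply/measurable_EFinP; apply: measurableT_comp; first exact: measurable_ln.
  exact: measurable_cabs.
Qed.

(** With the convention on [oo - oo], a finite integral forces the positive and
    the negative part to have finite integrals. *)
Lemma log_integrable f : cmeasurable f ->
  (`| \int[mu]_k log f k | < +oo)%E -> mu.-integrable setT (log f).
Proof.
move=> /measurable_log mf fin; apply/integrableP; split=> //.
have mp := measurable_funepos mf; have mn := measurable_funeneg mf.
have -> : (\int[mu]_k `|log f k|)%E =
    (\int[mu]_k (log f)^\+ k + \int[mu]_k (log f)^\- k)%E.
  rewrite -ge0_integralD//; apply: eq_integral => k _.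
  by rewrite -/((abse \o log f) k) fune_abse.
move: fin; rewrite integralE.
have : (0 <= \int[mu]_k (log f)^\+ k)%E by apply: integral_ge0.
have : (0 <= \int[mu]_k (log f)^\- k)%E by apply: integral_ge0.
move: (\int[mu]_k (log f)^\- k)%E (\int[mu]_k (log f)^\+ k)%E.
by move=> [b| |] [a| |] //= _ _ _; rewrite ltry.
Qed.

Let invariant_integral_ge0 h : measurable_fun setT h -> (forall k, (0 <= h k)%E) ->
  (\int[mu]_k h (phi k) = \int[mu]_k h k)%E.
Proof.
move=> mh h0; have := @ge0_integral_pushforward _ _ _ _ _ _ phi_pres.1 mu setT h
  measurableT mh (fun k _ => h0 k).
rewrite preimage_setT => <-.
apply: eq_measure_integral; first exact: phi_pres.1.
by move=> ? A mA _; exact: (phi_pres.2 A mA).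
Qed.

Lemma invariant_integrable h : mu.-integrable setT h ->
  mu.-integrable setT (h \o phi).
Proof.
move=> /integrableP[mh hfin]; apply/integrableP; split.
  exact: (measurableT_comp mh phi_pres.1).
have := invariant_integral_ge0 (measurableT_comp (@abse_measurable R setT) mh)
  (fun k => abse_ge0 (h k)).
by move=> /= ->.
Qed.

Lemma invariant_integral h : mu.-integrable setT h ->
  (\int[mu]_k h (phi k) = \int[mu]_k h k)%E.
Proof.
move=> hi; have /integrableP[mh _] := hi.
have := @integral_pushforward _ _ _ _ _ _ phi_pres.1 mu setT h mh.
rewrite preimage_setT => /(_ (invariant_integrable hi) measurableT) <-.
apply: eq_measure_integral; first exact: phi_pres.1.
by move=> ? A mA _; exact: (phi_pres.2 A mA).
Qed.

Let log_fin f k : log f k \is a fin_num -> 0 < cabs (f k).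
Proof. by rewrite /log /=; case: ltP. Qed.

Lemma log_integrable_neq0 f : mu.-integrable setT (log f) ->
  \forall k \ae mu, f k != 0.
Proof.
move=> /(integrable_ae measurableT); apply: filterS => k /(_ Logic.I)/log_fin.
by rewrite cabs_gt0.
Qed.

(** Integrating the logarithm of [|w| |f o phi| = l |f|] gives [ln l] as the
    integral of [ln |w|], whatever [f]. *)
Lemma log_integrable_eigenvalue f g (w : borel K -> R) (l l' : R) :
  cmeasurable f -> cmeasurable g ->
  mu.-integrable setT (log f) -> mu.-integrable setT (log g) -> 0 < l -> 0 < l' ->
  (\forall k \ae mu, w k * cabs (f (phi k)) = l * cabs (f k)) ->
  (\forall k \ae mu, w k * cabs (g (phi k)) = l' * cabs (g k)) -> l = l'.
Proof.
move=> mf mg fi gi l0 l'0 hf hg.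
have fphi := invariant_integrable fi; have gphi := invariant_integrable gi.
have cst_int (r : R) : mu.-integrable setT (cst r%:E).
  exact: (finite_measure_integrable_cst mu r measurableT).
have E : \forall k \ae mu, ((ln l)%:E + (log f k + (log g \o phi) k) =
    (ln l')%:E + (log g k + (log f \o phi) k))%E.
  apply: filterS3 (filterI hf hg)
    (filterI (log_integrable_neq0 fi) (log_integrable_neq0 gi))
    (preserving_ae phi_pres (filterI (log_integrable_neq0 fi) (log_integrable_neq0 gi))).
  move=> k [] + + [] + + []; rewrite -!cabs_gt0 /= /log.
  move: (cabs (f k)) (cabs (g k)) (cabs (f (phi k))) (cabs (g (phi k))).
  move=> a b a' b' h1 h2 a0 b0 a'0 b'0.
  rewrite !lne_EFin// -!EFinD -!lnM ?posrE ?mulr_gt0//; congr (ln _)%:E.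
  have w0 : w k != 0.
    by apply/eqP => w0; move: h1; rewrite w0 mul0r => /esym/eqP; rewrite gt_eqF ?mulr_gt0.
  apply: (mulfI w0).
  have -> : w k * (l * (a * b')) = (w k * b') * (l * a) by ring.
  by rewrite h2 -h1; ring.
have mphi h : measurable_fun setT h -> measurable_fun setT (h \o phi).
  by move=> mh; exact: (measurableT_comp mh phi_pres.1).
have mlf := measurable_log mf; have mlg := measurable_log mg.
have : (\int[mu]_k ((ln l)%:E + (log f k + (log g \o phi) k)) =
    \int[mu]_k ((ln l')%:E + (log g k + (log f \o phi) k)))%E.
  apply: ae_eq_integral => //.
  - apply: emeasurable_funD; first exact: measurable_cst.
    by apply: emeasurable_funD => //; exact: mphi.
  - apply: emeasurable_funD; first exact: measurable_cst.
    by apply: emeasurable_funD => //; exact: mphi.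
  - by apply: filterS E => k h _.
rewrite (integralD measurableT (cst_int _) (integrableD measurableT fi gphi)).
rewrite (integralD measurableT (cst_int _) (integrableD measurableT gi fphi)).
rewrite (integralD measurableT fi gphi) (integralD measurableT gi fphi) /=.
have int_cst (r : R) : (\int[mu]_k r%:E = r%:E)%E.
  transitivity (r%:E * mu [set: borel K])%E; first exact: integral_cst.
  by rewrite probability_setT mule1.
rewrite !invariant_integral// !int_cst.
have /fineK <- := integrable_fin_num measurableT fi.
have /fineK <- := integrable_fin_num measurableT gi.
rewrite -!EFinD => -[E1]; apply: ln_inj; rewrite ?posrE//.
by move: E1; lra.
Qed.

End LogIntegral.

(** * Bands of functions vanishing off a set *)

Section Bands.
Context {R : realType} {K : ptopologicalType} {mu : probability (borel K) R}.
Context {X : completeNormedModType R[i]} {rep : X -> K -> R[i]}.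
Hypothesis HX : Banach_ideal mu rep.
Implicit Types (x y : X) (E : set (borel K)).

Definition set_band E : set X := [set x | \forall k \ae mu, ~ E k -> rep x k = 0].

Lemma restr_set_band E x : measurable E -> set_band E (restr mu rep E x).
Proof.
move=> mE; apply: filterS (restrE HX x mE) => k -> nE.
by rewrite indicE memNset// mulr0n mul0r.
Qed.

Lemma set_band_band E : measurable E -> band mu rep (set_band E).
Proof.
move=> mE; have lin : linear_subspace (set_band E).
  split=> [|a x y xE yE]; first by apply: filterS (rep0 HX).
  apply: filterS3 xE yE (rep_lin HX a x y) => k hx hy -> nE.
  by rewrite hx// hy// mulr0 addr0.
split; [split=> // x z zE|move=> D s DE [ub lub]].
  move=> xz; apply: filterS2 zE xz => k h; rewrite le_cabs => le nE.
  move: le; rewrite h// cabs0 => le; apply/eqP; rewrite -cabs_eq0 eq_le le.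
  exact: cabs_ge0.
(* The restriction of the supremum to E is again an upper bound. *)
have sE : le_X mu rep s (restr mu rep E s).
  apply: lub => x Dx; apply: filterS3 (ub x Dx) (DE x Dx) (restrE HX s mE).
  move=> k xs xE ->; rewrite indicE; case: (boolP (k \in E)) => [_|/negP nE].
    by rewrite mulr1n mul1r.
  by rewrite mulr0n mul0r xE// => Ek; apply: nE; rewrite inE.
have [[x Dx]|nD] := pselect (exists x, D x).
  apply: filterS3 (filterI (ub x Dx) (DE x Dx)) sE (restrE HX s mE).
  move=> k [xs xE] ss se nE; apply: le_anti; move: ss xs.
  by rewrite se indicE memNset// mulr0n mul0r xE// => -> ->.
(* An upper bound of the empty set lies below twice itself. *)
have s2 : le_X mu rep s (s + s) by apply: lub => x Dx; case: nD; exists x.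
apply: filterS3 (filterI s2 (repD HX s s)) sE (restrE HX s mE).
move=> k [h hs] ss se nE; apply: le_anti; move: ss h.
by rewrite se indicE memNset// mulr0n mul0r hs lerDl => -> ->.
Qed.

(** A component [z] differs from the restriction by an element of the band,
    from which [x - z] is disjoint. *)
Lemma band_projE E x : measurable E ->
  band_proj mu rep (set_band E) x = restr mu rep E x.
Proof.
move=> mE; rewrite /band_proj; case: xgetP => [z _ [zE zd]|]; last first.
  move=> /(_ (restr mu rep E x)) [].
  split=> [|u uE]; first exact: restr_set_band.
  apply: filterS3 uE (repB HX x (restr mu rep E x)) (restrE HX x mE) => k uE -> ->.
  rewrite indicE; case: (boolP (k \in E)) => [_|/negP nE].
    by rewrite mulr1n mul1r subrr normr0 min_l.
  by rewrite uE ?normr0 ?min_r// => Ek; apply: nE; rewrite inE.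
have dE : set_band E (restr mu rep E x - z).
  have [[[_ lin] _] _] := set_band_band mE.
  by rewrite addrC -scaleN1r; apply: lin => //; exact: restr_set_band.
apply/esym/eqP; rewrite -subr_eq0; apply/eqP; apply: (rep_eq HX).
apply: filterS3 (filterI dE (zd _ dE)) (filterI (rep0 HX) (restrE HX x mE))
  (filterI (repB HX x z) (repB HX (restr mu rep E x) z)).
move=> k [d0 dd] [-> rE] [xz dz].
have [Ek|/d0//] := pselect (E k).
move: dd; rewrite xz dz rE indicE mem_set// mulr1n mul1r min_l// => /eqP.
by rewrite normr_eq0 => /eqP.
Qed.

(** Were the band trivial, the functions [\1_E] and 0 would define the same
    multiplication operator. *)
Lemma set_band_neq0 E : center_is_Linfty mu rep -> measurable E ->
  (0 < mu E)%E -> set_band E <> [set 0].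
Proof.
move=> [_ uniq] mE E0 Z0.
have rE0 x : restr mu rep E x = 0.
  by have := restr_set_band x mE; rewrite Z0.
have L (m : borel K -> R[i]) : cmeasurable m -> (forall k, cabs (m k) <= 1) ->
    Linfty mu m.
  move=> mm m1; split=> //; exists 1; apply/aeW => k.
  by rewrite normC_cabs -[1]/((1 : R)%:C) lecR.
have := uniq (\1_E) (cst 0) (fun=> 0) (L _ (cmeasurable_indic mE) _)
  (L _ (cmeasurable_cst _) _).
move=> /(_ _ _ _ _)[| | | |A [mA A0 EA]].
- by move=> k; rewrite indicE; case: (_ \in _); rewrite ?mulr1n ?cabs1 ?mulr0n ?cabs0.
- by move=> k; rewrite cabs0.
- by move=> x; rewrite -(rE0 x); exact: restrE.
- by move=> x; apply: filterS (rep0 HX) => k ->; rewrite mul0r.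
have : (mu E <= mu A)%E.
  apply: le_measure; rewrite ?inE// => k Ek; apply: EA => /= h.
  by move/eqP: h; rewrite indicE mem_set// mulr1n oner_eq0.
by rewrite A0 leNgt E0.
Qed.

Lemma almost_localized_restr (Y : set X) : center_is_Linfty mu rep ->
  almost_localized mu rep Y -> forall E, measurable E -> (0 < mu E)%E ->
  forall e : R, 0 < e ->
  exists u, [/\ Y u, rn u = 1 & rn (u - restr mu rep E u) < e].
Proof.
move=> cX loc E mE E0 e e0.
have [|u [Yu /unit_rn u1 ue]] := loc _ (set_band_band mE) (set_band_neq0 cX mE E0) e%:C.
  by rewrite ltcR.
by exists u; split=> //; move: ue; rewrite band_projE// rnE ltcR.
Qed.

End Bands.

(** * Spectra in terms of real numbers *)

Section Spectra.
Context {R : realType} {X : completeNormedModType R[i]}.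
Implicit Types (Y : set X) (T : X -> X) (lam : R[i]).

Lemma sigma_apP Y T lam : sigma_ap Y T lam <->
  forall e : R, 0 < e -> exists y, [/\ Y y, rn y = 1 & rn (T y - lam *: y) < e].
Proof.
split=> [[y [Yy /rn_cvgP h]] e /h[N hN]|h].
  have [Yn yn] := Yy N; exists (y N); split=> //; first exact/unit_rn.
  by have := hN N (leqnn N); rewrite subr0.
have /choice[y hy] : forall n, exists y, [/\ Y y, rn y = 1 &
    rn (T y - lam *: y) < (n.+1%:R)^-1].
  by move=> n; apply: h; rewrite invr_gt0.
exists y; split=> [n|]; first by have [? /unit_rn ?] := hy n.
apply/rn_cvgP => e e0; exists (Num.truncn e^-1) => n Nn.
have [_ _ yn] := hy n; rewrite subr0 (lt_trans yn)// invf_plt ?posrE//.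
by rewrite (lt_le_trans (truncnS_gt _))// ler_nat ltnS.
Qed.

Lemma not_sigma_ap Y T lam : linear_subspace Y -> linear T -> ~ sigma_ap Y T lam ->
  exists2 e : R, 0 < e & forall y, Y y -> e * rn y <= rn (lam *: y - T y).
Proof.
move=> [Y0 YL] linT nl; apply: contrapT => h; apply: nl; apply/sigma_apP => e e0.
apply: contrapT => nex; apply: h; exists e => // y Yy; rewrite rnB leNgt.
apply/negP => lt; apply: nex.
have [y0|/eqP y0] := eqVneq y 0.
  by move: lt; rewrite y0 rn0 mulr0 ltNge rn_ge0.
have ry := rn_gt0 y0.
pose TL := as_linear linT.
exists ((rn y)^-1%:C *: y); split.
- by rewrite -[_ *: _]addr0; exact: YL.
- by rewrite rnZ cabs_real ger0_norm ?invr_ge0 ?rn_ge0// mulVf// gt_eqF.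
- have -> : T ((rn y)^-1%:C *: y) - lam *: ((rn y)^-1%:C *: y) =
      (rn y)^-1%:C *: (T y - lam *: y).
    by rewrite -[T]/(TL : X -> X) [TL _]linearZ scalerBr !scalerA [lam * _]mulrC.
  rewrite rnZ cabs_real ger0_norm ?invr_ge0 ?rn_ge0// mulrC ltr_pdivrMr//.
Qed.

Lemma invertible_bounded_below (Y : set X) (A : X -> X) : invertible_on Y A ->
  exists2 c : R, 0 <= c & forall y, Y y -> rn y <= c * rn (A y).
Proof.
move=> [_ [c h]]; exists (cabs c) => [|y Yy]; first exact: cabs_ge0.
exact/le_rnM/h.
Qed.

Lemma has_dim0 : has_dim [set (0 : X)] 0.
Proof.
exists (fun _ => 0); split=> [c _ []//|].
by apply/seteqP; split=> [_ ->|_ [c _ <-]]; [exists (fun=> 0)|];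
  rewrite ?big_ord0.
Qed.

Lemma has_dim_trivial n : has_dim [set (0 : X)] n -> n = 0%N.
Proof.
case: n => // n [e [indep E]].
have e0 : e ord0 = 0.
  have : [set \sum_i c i *: e i | c in [set: 'I_n.+1 -> R[i]]] (e ord0).
    exists (fun i => (i == ord0)%:R) => //.
    rewrite (bigD1 ord0)//= ?eqxx ?mulr1n scale1r big1 ?addr0// => i /negbTE ->.
    by rewrite scale0r.
  by rewrite -E.
have E1 : \sum_i (i == ord0)%:R *: e i = 0.
  rewrite (bigD1 ord0)//= ?eqxx ?mulr1n scale1r e0 add0r big1// => i /negbTE ->.
  by rewrite scale0r.
by have /eqP := indep _ E1 ord0; rewrite eqxx mulr1n oner_eq0.
Qed.

Section Restriction.
Variables (Y : set X) (T : X -> X) (c : R).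
Hypotheses (Y_sub : linear_subspace Y) (Y_closed : closed Y).
Hypotheses (linT : linear T) (TY : forall y, Y y -> Y (T y)).
Hypotheses (c0 : 0 <= c) (Tc : forall x, rn (T x) <= c * rn x).
Variable lam : R[i].
Let S y := lam *: y - T y.

Lemma shifted_linear : linear S.
Proof.
move=> a x y; rewrite /S linT scalerDr scalerA mulrC -scalerA opprD addrACA.
by rewrite scalerBr.
Qed.
Let SL := as_linear shifted_linear.

Lemma shifted_subspace y : Y y -> Y (S y).
Proof.
have [Y0 YL] := Y_sub; move=> Yy; rewrite /S addrC -scaleN1r.
apply: (YL); first exact: TY.
by rewrite -[_ *: _]addr0; exact: YL.
Qed.

Lemma shifted_bound x : rn (S x) <= (cabs lam + c) * rn x.
Proof. by rewrite mulrDl; apply: rnD2; rewrite ?rnZ ?rnN. Qed.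

Lemma closed_range (e : R) : 0 < e ->
  (forall y, Y y -> e * rn y <= rn (S y)) -> closed (range_on Y S).
Proof.
move=> e0 below; apply: closed_rn => z hz.
have [Y0 YL] := Y_sub.
have /choice[u hu] : forall n : nat, exists u, Y u /\ rn (z - S u) < n.+1%:R^-1.
  by move=> n; have [|_ [u Yu <-]] := hz n.+1%:R^-1; [rewrite invr_gt0|exists u].
have small (d : R) : 0 < d -> exists N, forall n, (N <= n)%N -> n.+1%:R^-1 < d.
  move=> d0; exists (Num.truncn d^-1) => n Nn; rewrite invf_plt ?posrE//.
  by rewrite (lt_le_trans (truncnS_gt _))// ler_nat ltnS.
have Su n m : rn (S (u n) - S (u m)) <= n.+1%:R^-1 + m.+1%:R^-1.
  apply: (le_trans (rn_triangle _ z _)); apply: lerD; last by have [_ /ltW] := hu m.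
  by rewrite rnB; have [_ /ltW] := hu n.
have [d d0|l Yl ul] := subspace_complete Y_closed (fun n => (hu n).1).
  have [|N hN] := small (e * d / 2); first by rewrite divr_gt0// mulr_gt0.
  exists N => n Nn; rewrite -(ltr_pM2l e0).
  have Yd : Y (u n - u N).
    by rewrite addrC -scaleN1r; apply: (YL); [exact: (hu N).1|exact: (hu n).1].
  apply: (le_lt_trans (below _ Yd)).
  have -> : S (u n - u N) = S (u n) - S (u N).
    by rewrite -[S]/(SL : X -> X) linearB.
  by rewrite (le_lt_trans (Su n N))// [ltRHS]splitr ltrD ?hN.
exists l => //; apply/eqP; rewrite eq_sym -subr_eq0; apply/eqP.
apply: rn_eq0; apply/eqP; rewrite eq_le rn_ge0 andbT.
apply/ler_addgt0Pr => d d0; rewrite add0r.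
have d2 : 0 < d / 2 by rewrite divr_gt0.
have cl : 0 < cabs lam + c + 1 by rewrite ltr_wpDl ?addr_ge0 ?cabs_ge0.
have [N1 h1] := small _ d2.
have [N2 h2] := ul _ (divr_gt0 d2 cl).
pose n := maxn N1 N2.
have k1 := h1 n (leq_maxl _ _); have k2 := h2 n (leq_maxr _ _).
apply: (le_trans (rn_triangle _ (S (u n)) _)).
have -> : S (u n) - S l = S (u n - l) by exact/esym/(linearB SL).
have := shifted_bound (u n - l).
have : (cabs lam + c) * rn (u n - l) <= d / 2.
  move: k2; rewrite ltr_pdivlMr// => k2.
  by have := rn_ge0 (u n - l); move: k2; rewrite mulrC mulrDl mul1r; lra.
have [_ h3] := hu n.
by move: (lt_trans h3 k1); lra.
Qed.

Lemma below_kernel (e : R) : 0 < e ->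
  (forall y, Y y -> e * rn y <= rn (S y)) -> ker_on Y S = [set 0].
Proof.
move=> e0 below; apply/seteqP; split=> [y [Yy Sy]|_ ->]; last first.
  by split; [have [] := Y_sub|rewrite -[S]/(SL : X -> X) linear0].
apply: rn_eq0; apply/eqP; rewrite eq_le rn_ge0 andbT.
by have := below y Yy; rewrite Sy rn0 pmulr_rle0.
Qed.

End Restriction.
End Spectra.

(** * Weighted compositions on an almost localized subspace *)

Section Main.
Context {R : realType} {K : ptopologicalType} {mu : probability (borel K) R}.
Context {X : completeNormedModType R[i]} {rep : X -> K -> R[i]}.
Hypothesis HX : Banach_ideal mu rep.
Implicit Types (x y : X) (E : set (borel K)).

Definition localized_family (Y : set X) (S : X -> X) n (eta : R) :=
  exists (D : 'I_n -> set (borel K)) (y : 'I_n -> X),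
    (forall i, [/\ measurable (D i), Y (y i), rn (y i) = 1,
       rn (S (y i)) <= eta & rn (y i - restr mu rep (D i) (y i)) <= eta]) /\
    forall i j, i <> j -> D i `&` D j = set0.

(** Restricting a relation to [D i] leaves [c i *: z i] almost alone, so each
    coefficient is at most a small multiple of the sum of their moduli. *)
Lemma localized_independent n (eta : R) (D : 'I_n -> set (borel K))
    (y z : 'I_n -> X) :
  (forall i, measurable (D i)) -> (forall i j, i <> j -> D i `&` D j = set0) ->
  (forall i, rn (y i) = 1) ->
  (forall i, rn (y i - restr mu rep (D i) (y i)) <= eta) ->
  (forall i, rn (y i - z i) <= eta) -> n%:R * (2 * eta) < 1 ->
  forall c : 'I_n -> R[i], \sum_i c i *: z i = 0 -> forall i, c i = 0.
Proof.
move=> mD dD y1 yD yz small c cz.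
pose s := \sum_i cabs (c i).
have bound i : cabs (c i) <= 2 * eta * s.
  have lin := restr_linear HX (mD i); pose Ri := as_linear lin.
  have Rz j : j != i -> rn (Ri (z j)) <= 2 * eta.
    move=> ji; have -> : Ri (z j) = Ri (z j - y j) +
        Ri (y j - restr mu rep (D j) (y j)).
      rewrite !linearB; have -> : Ri (restr mu rep (D j) (y j)) = 0.
        apply: (restr_disjoint HX) => //; apply: dD => E.
        by rewrite E eqxx in ji.
      by rewrite subr0 subrK.
    rewrite (_ : 2 * eta = eta + eta); last by ring.
    apply: rnD2; rewrite (le_trans (rn_restr HX _ (mD i)))//.
    by rewrite rnB.
  have Ri1 : 1 - 2 * eta <= rn (Ri (z i)).
    have E : y i = (y i - Ri (y i)) + (Ri (y i - z i) + Ri (z i)).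
      by rewrite linearB !subrK.
    have := rnD (y i - Ri (y i)) (Ri (y i - z i) + Ri (z i)); rewrite -E y1.
    have := rnD (Ri (y i - z i)) (Ri (z i)).
    have := yD i; have := yz i; have := rn_restr HX (y i - z i) (mD i).
    by rewrite /Ri /=; lra.
  have E : c i *: Ri (z i) = - \sum_(j | j != i) c j *: Ri (z j).
    apply/eqP; rewrite -addr_eq0; apply/eqP.
    transitivity (Ri (\sum_j c j *: z j)); last by rewrite cz linear0.
    rewrite [in RHS](bigD1 i)// linearD linearZ linear_sum; congr (_ + _).
    by apply: eq_bigr => j _; rewrite linearZ.
  have h : cabs (c i) * rn (Ri (z i)) <= 2 * eta * \sum_(j | j != i) cabs (c j).
    rewrite -rnZ E rnN (le_trans (rn_sum _ _ _))// mulr_sumr.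
    by apply: ler_sum => j ji; rewrite rnZ mulrC ler_wpM2r ?cabs_ge0// Rz.
  have := ler_wpM2l (cabs_ge0 (c i)) Ri1.
  by rewrite /s (bigD1 i)//=; lra.
have s0 : 0 <= s by apply: sumr_ge0 => i _; exact: cabs_ge0.
have sn : s <= n%:R * (2 * eta) * s.
  have : s <= \sum_(i < n) 2 * eta * s by apply: ler_sum => i _; exact: bound.
  by rewrite sumr_const card_ord -[_ *+ n]mulr_natl mulrA.
have s_eq0 : s = 0.
  apply/eqP; rewrite eq_le s0 andbT leNgt; apply/negP => sp.
  by have := ltr_pM2r sp (n%:R * (2 * eta)) 1; rewrite small mul1r ltNge sn.
move=> i; apply/eqP; rewrite -cabs_eq0 eq_le cabs_ge0 andbT.
rewrite -s_eq0 /s (bigD1 i)//= lerDl.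
by apply: sumr_ge0 => j _; exact: cabs_ge0.
Qed.

Lemma localized_robust_kernel Y (S : X -> X) :
  (forall n (eta : R), 0 < eta -> localized_family Y S n eta) -> robust_kernel Y S.
Proof.
move=> fam n; pose th : R := (4 * n.+1%:R)^-1.
have th0 : 0 < th by rewrite invr_gt0 mulr_gt0.
have small : n%:R * (2 * th) < 1.
  have E : th * (4 * n.+1%:R) = 1 by rewrite mulVf// gt_eqF// mulr_gt0.
  rewrite -natr1 in E; have n0 : 0 <= n%:R :> R by [].
  have : 0 <= n%:R * th by rewrite mulr_ge0// ltW.
  by move: E; lra.
exists th => // eta eta0.
have [|D [y [hy dD]]] := fam n (Num.min eta th); first by rewrite lt_min eta0.
exists y; split=> [i|z yz].
  have [_ Yi y1 Si _] := hy i; split=> //.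
  by rewrite (le_trans Si)// ge_min lexx.
apply: (@localized_independent n th D y) => // i; have [mi _ y1 _ yD] := hy i => //.
by rewrite (le_trans yD)// ge_min lexx orbT.
Qed.

Variables (phi psi : K -> K) (U V W : X -> X) (Y : set X) (w : K -> R[i]).
Hypotheses (K_hausdorff : hausdorff_space K) (phi_cont : continuous phi).
Hypotheses (phi_pres : preserving mu (phi : borel K -> borel K)).
Hypotheses (psi_pres : preserving mu (psi : borel K -> borel K)).
Hypotheses (phiK : cancel phi psi) (psiK : cancel psi phi).
Hypotheses (mu_reg : regular_measure mu).
Hypotheses (mu_per : mu (periodic_points phi) = 0%E).
Hypotheses (Ucomp : wcomp mu rep (cst 1) phi U).
Hypotheses (Vcomp : wcomp mu rep (cst 1) psi V).
Variables cU cV cW : R.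
Hypotheses (cU0 : 0 <= cU) (Ubound : forall x, rn (U x) <= cU * rn x).
Hypotheses (cV0 : 0 <= cV) (Vbound : forall x, rn (V x) <= cV * rn x).
Hypotheses (cW0 : 0 <= cW) (Wbound : forall x, rn (W x) <= cW * rn x).
Hypotheses (growU : forall s : R, 1 < s -> grows_at_most U s).
Hypotheses (growV : forall s : R, 1 < s -> grows_at_most V s).
Hypotheses (Y_sub : linear_subspace Y) (Y_closed : closed Y).
Hypotheses (UY : U @` Y = Y) (WY : W @` Y `<=` Y).
Hypotheses (mw : cmeasurable (w : borel K -> R[i])) (Wmul : wcomp mu rep w id W).
Hypothesis Yloc : forall E, measurable E -> (0 < mu E)%E -> forall e : R, 0 < e ->
  exists u, [/\ Y u, rn u = 1 & rn (u - restr mu rep E u) < e].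

Let T := W \o U.
Let UK := composition_inverse HX psi_pres psiK Ucomp Vcomp.

Lemma weighted_wcomp : wcomp mu rep w phi T.
Proof.
move=> x; apply: filterS2 (Wmul (U x)) (Ucomp x) => k -> ->.
by rewrite /= mul1r.
Qed.

Lemma weighted_linear : linear T.
Proof. exact: (wcomp_linear HX phi_pres weighted_wcomp). Qed.

Lemma weighted_stable y : Y y -> Y (T y).
Proof.
move=> Yy; apply: WY; exists (U y) => //.
by rewrite -[Y]UY; exists y.
Qed.

Lemma weighted_bound x : rn (T x) <= cW * cU * rn x.
Proof. by rewrite (le_trans (Wbound _))// -mulrA ler_wpM2l. Qed.

Let YV y : Y y -> Y (V y).
Proof. by rewrite -{1}[Y]UY => -[x Yx <-]; rewrite UK. Qed.

(** Disjoint pieces of one wandering set have disjoint orbits. *)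
Lemma localized_family_neq0 lam alpha n (eta : R) : lam != 0 -> cabs alpha = 1 ->
  sigma_ap Y T lam -> 0 < eta ->
  localized_family Y (fun y => alpha * lam *: y - T y) n eta.
Proof.
move=> l0 a1 /sigma_apP ap eta0.
have cl0 : 0 < cabs lam by rewrite cabs_gt0.
pose T' x := lam^-1 *: T x.
have wT' : wcomp mu rep (fun k => lam^-1 * w k) phi T'.
  move=> x; apply: filterS2 (repZ HX lam^-1 (T x)) (weighted_wcomp x).
  by move=> k -> ->; rewrite mulrA.
have mw' : cmeasurable (fun k : borel K => lam^-1 * w k).
  exact: cmeasurableM (cmeasurable_cst _) mw.
have T'b x : rn (T' x) <= (cabs lam)^-1 * (cW * cU) * rn x.
  rewrite rnZ cabsV -mulrA ler_wpM2l ?invr_ge0 ?(ltW cl0)//.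
  exact: weighted_bound.
have b0 : 0 <= (cabs lam)^-1 * (cW * cU).
  by rewrite !mulr_ge0// invr_ge0 ltW.
have T'Y : T' @` Y `<=` Y.
  move=> _ [y Yy <-]; have [Y0 YL] := Y_sub; rewrite /T' -[_ *: _]addr0.
  by apply: YL => //; exact: weighted_stable.
have ap' (e : R) : 0 < e -> exists2 x, rn x = 1 & rn (T' x - x) < e.
  move=> e0; have [y [Yy y1 yT]] := ap _ (mulr_gt0 cl0 e0).
  exists y => //; have -> : T' y - y = lam^-1 *: (T y - lam *: y).
    by rewrite scalerBr scalerA mulVf// scale1r.
  by rewrite rnZ cabsV mulrC ltr_pdivrMr// mulrC.
pose eta' := Num.min eta (eta / cabs lam).
have eta'0 : 0 < eta' by rewrite lt_min eta0 divr_gt0.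
have [N [F [mF F0 hF]]] := localized_eigenvectors HX phi_pres psi_pres phiK psiK
  Ucomp Vcomp growU growV wT' mw' b0 T'b Y_sub T'Y Yloc a1 eta'0 ap'.
have [G [mG GF G0 wG]] := positive_wandering_subset K_hausdorff phi_cont mu_reg
  mu_per N.*2 mF F0.
have [E [hE dE]] := split_positive K_hausdorff phi_cont phi_pres mu_reg mu_per n mG G0.
have /choice[y hy] : forall i : 'I_n, exists y, [/\ Y y, rn y = 1,
    rn (T' y - alpha *: y) <= eta' &
    rn (y - restr mu rep (orbit_set phi N (E i)) y) <= eta'].
  move=> i; have [mEi EG Ei0] := hE i (ltn_ord i); apply: hF => //.
    exact: subset_trans GF.
  exact: wanderingS wG.
exists (fun i => orbit_set phi N (E i)), y; split=> [i|i j ij].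
  have [Yi y1 yT yD] := hy i; split=> //.
  - by apply: (measurable_orbit_set phi_pres); have [] := hE i (ltn_ord i).
  - have -> : (alpha * lam) *: y i - T (y i) = - (lam *: (T' (y i) - alpha *: y i)).
      by rewrite scalerBr !scalerA mulfV// scale1r opprB mulrC.
    rewrite rnN rnZ mulrC -ler_pdivlMr// (le_trans yT)//.
    by rewrite ge_min lexx orbT.
  - by rewrite (le_trans yD)// ge_min lexx.
apply/seteqP; split=> // k [[a /= aN Ea] [b /= bN Eb]].
have [_ EGi _] := hE i (ltn_ord i); have [_ EGj _] := hE j (ltn_ord j).
have [ab|/eqP ab] := eqVneq a b.
  have nij : nat_of_ord i <> j by move=> E'; apply: ij; exact: val_inj.
  suff : (E i `&` E j) (iter a phi k).
    by rewrite (dE _ _ (ltn_ord i) (ltn_ord j) nij).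
  by split; [exact: Ea|rewrite ab].
suff : (iter a phi @^-1` G `&` iter b phi @^-1` G) k.
  by rewrite (wandering_disjoint wG ab (ltnW aN) (ltnW bN)).
by split; [exact: EGi|exact: EGj].
Qed.

(** If 0 is an approximate eigenvalue, then [w] is small on a set of positive
    measure, and [V u] works for every [u] almost carried by a piece of it. *)
Lemma localized_family_eq0 n (eta : R) : sigma_ap Y T 0 -> 0 < eta ->
  localized_family Y (fun y => 0 *: y - T y) n eta.
Proof.
move=> /sigma_apP ap eta0.
have mcw : measurable_fun [set: borel K] (cabs \o (w : borel K -> R[i])).
  exact: measurable_cabs.
have cU1 : 0 < cU + 1 by rewrite ltr_wpDl.
pose d := eta / (2 * (cU + 1)).
have d0 : 0 < d by rewrite divr_gt0// mulr_gt0.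
have dE : d * (cU + 1) = eta / 2 by rewrite /d; field; rewrite gt_eqF.
pose A : set (borel K) := [set k | cabs (w k) < d].
have mA : measurable A by exact: (measurable_lt_set mcw (measurable_cst _)).
have A0 : (0 < mu A)%E.
  rewrite ltNge; apply/negP => neg.
  have bad : \forall k \ae mu, ~ A k by apply: negligibleP0 => //; rewrite ltNge neg.
  have [y [Yy y1]] := ap (d / (cV + 1)) (divr_gt0 d0 (ltr_wpDl cV0 ltr01)).
  rewrite scale0r subr0 ltr_pdivlMr ?ltr_wpDl// => Ty.
  have : d * rn (U y) <= rn (T y).
    have dz : 0 <= d^-1 by rewrite invr_ge0 ltW.
    rewrite mulrC -ler_pdivlMr// mulrC; apply: (rn_dominated HX dz).
    apply: filterS2 bad (Wmul (U y)) => k /negP; rewrite -leNgt => h ->.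
    by rewrite mulrC ler_pdivlMr// cabsM mulrC ler_wpM2r ?cabs_ge0.
  have := Vbound (U y); rewrite UK y1 => h1 h2.
  have := ler_wpM2l (ltW d0) h1; have := ler_wpM2l cV0 h2.
  by have := rn_ge0 (T y); lra.
have [E [hE dE']] := split_positive K_hausdorff phi_cont phi_pres mu_reg mu_per n mA A0.
pose e := eta / (2 * (cU + 1) * (cW + cV + 1)).
have cWV : 0 < cW + cV + 1 by rewrite ltr_wpDl// addr_ge0.
have e0 : 0 < e by rewrite divr_gt0// !mulr_gt0.
have eE : e * (cU + 1) * (cW + cV + 1) = eta / 2.
  by rewrite /e; field; rewrite !gt_eqF.
have Wlin := wcomp_linear HX (preserving_id mu) Wmul; pose WL := as_linear Wlin.
have Vlin := wcomp_linear HX psi_pres Vcomp; pose VL := as_linear Vlin.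
have Tlin := weighted_linear; pose TL := as_linear Tlin.
have VK x : U (V x) = x by apply: (composition_inverse HX phi_pres phiK Vcomp Ucomp).
have /choice[y hy] : forall i : 'I_n, exists y, [/\ Y y, rn y = 1,
    rn (T y) <= eta & rn (y - restr mu rep (psi @^-1` E i) y) <= eta].
  move=> i; have [mEi EA Ei0] := hE i (ltn_ord i).
  have [u [Yu u1 ue]] := Yloc mEi Ei0 e0.
  have uV : 1 <= cU * rn (V u) by have := Ubound (V u); rewrite VK u1.
  have v0 : 0 < rn (V u).
    rewrite lt_neqAle rn_ge0 andbT; apply/eqP => v0.
    by move: uV; rewrite -v0 mulr0 ler10.
  pose t := (rn (V u))^-1.
  have t0 : 0 < t by rewrite invr_gt0.
  have ct : cabs t%:C = t by rewrite cabs_real ger0_norm// ltW.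
  have tU : t <= cU + 1.
    by rewrite /t -div1r ler_pdivrMr//; have := ltW v0; lra.
  have WEu : rn (W u) <= d + cW * e.
    have -> : W u = W (restr mu rep (E i) u) + W (u - restr mu rep (E i) u).
      by rewrite -[W]/(WL : X -> X) -linearD addrC subrK.
    apply: rnD2; last by rewrite (le_trans (Wbound _))// ler_wpM2l// ltW.
    have := rn_dominated HX (x := W (restr mu rep (E i) u)) (y := u) (ltW d0).
    rewrite u1 mulr1; apply.
    apply: filterS2 (Wmul (restr mu rep (E i) u)) (restrE HX u mEi) => k -> /= ->.
    rewrite mulrA cabsM ler_wpM2r ?cabs_ge0// indicE.
    case: (boolP (k \in E i)) => [|_]; last by rewrite mulr0n mulr0 cabs0 ltW.
    by rewrite inE mulr1n mulr1 => /EA/ltW.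
  exists (t%:C *: V u); split.
  - have [Y0 YL] := Y_sub; rewrite -[_ *: _]addr0; apply: YL => //.
    exact: YV.
  - by rewrite rnZ ct mulVf// gt_eqF.
  - have -> : T (t%:C *: V u) = t%:C *: W u.
      by rewrite -[T]/(TL : X -> X) linearZ /= /T /= VK.
    rewrite rnZ ct; apply: (le_trans (ler_wpM2r (rn_ge0 _) tU)).
    apply: (le_trans (ler_wpM2l (ltW cU1) WEu)).
    have : 0 <= e * (cU + 1) * (cV + 1).
      by apply: mulr_ge0; [apply: mulr_ge0; exact: ltW|exact: addr_ge0].
    by move: dE eE; lra.
  - have mP := preserving_preimage psi_pres mEi.
    have Rlin := restr_linear HX mP; pose RL := as_linear Rlin.
    have -> : t%:C *: V u - restr mu rep (psi @^-1` E i) (t%:C *: V u) =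
        t%:C *: V (u - restr mu rep (E i) u).
      rewrite -[restr mu rep _]/(RL : X -> X) linearZ -scalerBr; congr (_ *: _).
      rewrite -[V]/(VL : X -> X) linearB; congr (_ - _).
      exact/esym/(wcomp_restr_commute HX u psi_pres mEi Vcomp).
    rewrite rnZ ct; apply: (le_trans (ler_wpM2r (rn_ge0 _) tU)).
    have h : rn (V (u - restr mu rep (E i) u)) <= cV * e.
      by rewrite (le_trans (Vbound _))// ler_wpM2l// ltW.
    apply: (le_trans (ler_wpM2l (ltW cU1) h)).
    have : 0 <= e * (cU + 1) * (cW + 1).
      by apply: mulr_ge0; [apply: mulr_ge0; exact: ltW|exact: addr_ge0].
    by move: eE eta0; lra.
exists (fun i => psi @^-1` E i), y; split=> [i|i j ij].
  have [Yi y1 yT yD] := hy i; have [mEi _ _] := hE i (ltn_ord i); split=> //.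
    exact: (preserving_preimage psi_pres).
  by rewrite scale0r sub0r rnN.
have nij : nat_of_ord i <> j by move=> E'; apply: ij; exact: val_inj.
by rewrite -preimage_setI (dE' _ _ (ltn_ord i) (ltn_ord j) nij) preimage_set0.
Qed.

Lemma localized_families lam alpha n (eta : R) : cabs alpha = 1 ->
  sigma_ap Y T lam -> 0 < eta ->
  localized_family Y (fun y => alpha * lam *: y - T y) n eta.
Proof.
move=> a1 ap eta0; have [l0|l0] := eqVneq lam 0; last exact: localized_family_neq0.
by rewrite l0 mulr0; apply: localized_family_eq0 => //; rewrite -l0.
Qed.

Lemma sigma_ap_rotation : rotation_invariant (sigma_ap Y T).
Proof.
move=> a lam; rewrite /unit_circle /= normC_cabs => -[a1] ap.
apply/sigma_apP => e e0.
have e2 : 0 < e / 2 by rewrite divr_gt0.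
have [D [y [hy _]]] := localized_families 1 a1 ap e2.
have [_ Yy y1 yT _] := hy ord0; exists (y ord0); split=> //.
by rewrite rnB (le_lt_trans yT)//; lra.
Qed.

Let robust lam : sigma_ap Y T lam ->
  robust_kernel Y (fun y => lam *: y - T y).
Proof.
move=> ap; apply: localized_robust_kernel => n eta eta0.
by have := localized_families n (@cabs1 R) ap eta0; rewrite mul1r.
Qed.

Let cT0 : 0 <= cW * cU. Proof. exact: mulr_ge0. Qed.

Lemma sigma_ap_not_Phi_plus lam : sigma_ap Y T lam ->
  ~ Phi_plus_on Y (fun y => lam *: y - T y).
Proof.
move=> ap; exact: (@robust_not_Phi_plus _ _ Y
  (as_linear (shifted_linear weighted_linear lam)) _ Y_sub Y_closed
  (shifted_bound weighted_bound lam) (robust ap)).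
Qed.

Lemma not_sigma_ap_Phi_plus lam : ~ sigma_ap Y T lam ->
  Phi_plus_on Y (fun y => lam *: y - T y).
Proof.
move=> /(not_sigma_ap Y_sub weighted_linear)[e e0 below]; split.
  exact: (closed_range Y_sub Y_closed weighted_linear cT0 weighted_bound e0 below).
by exists 0%N; rewrite (below_kernel Y_sub weighted_linear e0 below); exact: has_dim0.
Qed.

Lemma sigma2_sigma_ap : sigma2 Y T = sigma_ap Y T.
Proof.
apply/seteqP; split=> lam /=; last exact: sigma_ap_not_Phi_plus.
by move=> nPhi; apply: contrapT => /not_sigma_ap_Phi_plus.
Qed.

(** A Weyl operator is in [Phi_+], so [lam - T] is then bounded below: its kernel
    is trivial, and so is its cokernel, of the same dimension. *)
Lemma spectrum_sigma4 : spectrum Y T = sigma4 Y T.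
Proof.
apply/seteqP; split=> lam /= nI; apply: contra_not nI.
  move=> [cR [n [kn rn_]]].
  have nap : ~ sigma_ap Y T lam.
    by move=> /sigma_ap_not_Phi_plus; apply; split=> //; exists n.
  have [e e0 below] := not_sigma_ap Y_sub weighted_linear nap.
  have ker0 := below_kernel Y_sub weighted_linear e0 below.
  rewrite ker0 in kn; have n0 := has_dim_trivial kn; rewrite n0 in rn_.
  have [b [_ _ span]] := rn_.
  pose S := as_linear (shifted_linear weighted_linear lam).
  split; last first.
    exists (e^-1)%:C => y Yy; rewrite !rnE -rmorphM lecR mulrC ler_pdivlMr//.
    by rewrite mulrC; exact: below.
  split.
  - by move=> y Yy; exact: (shifted_subspace Y_sub weighted_stable).
  - move=> x y; rewrite !inE => Yx Yy E.
    have : ker_on Y S (x - y).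
      split; last by rewrite linearB /S /= E subrr.
      by have [_ YL] := Y_sub; rewrite addrC -scaleN1r; exact: YL.
    by rewrite /S /= ker0 => /= /eqP; rewrite subr_eq0 => /eqP.
  - by move=> x Yx; have [c] := span x Yx; rewrite big_ord0 subr0.
move=> [[fY iY sY] [c hc]].
have rY : range_on Y (fun y => lam *: y - T y) = Y.
  by apply/seteqP; split=> [_ [y Yy <-]|]; [exact: fY|exact: sY].
split; first by rewrite rY.
exists 0%N; split.
  have -> : ker_on Y (fun y => lam *: y - T y) = [set 0]; last exact: has_dim0.
  apply/seteqP; split=> [y [Yy Sy]|_ ->].
    by have := le_rnM (hc y Yy); rewrite Sy rn0 mulr0 => /= h; apply: rn_eq0;
      apply/eqP; rewrite eq_le h rn_ge0.
  by have [Y0 _] := Y_sub; split=> //;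
    exact: (linear0 (as_linear (shifted_linear weighted_linear lam))).
exists (fun=> 0); split=> [[]//|c' _ []//|x Yx].
by exists (fun=> 0); rewrite big_ord0 subr0 rY.
Qed.

Hypothesis Ylog : forall y, Y y -> y <> 0 -> finite_log_integral mu rep y.

Let Yint y : Y y -> y <> 0 ->
  mu.-integrable setT (fun k : borel K => lne (cabs (rep y k))%:E).
Proof.
move=> Yy y0; apply: log_integrable; first exact: (rep_measurable HX).
exact: Ylog.
Qed.

Lemma eigenvalue_modulus lam lam' y y' : lam != 0 -> lam' != 0 ->
  Y y -> y <> 0 -> T y = lam *: y -> Y y' -> y' <> 0 -> T y' = lam' *: y' ->
  cabs lam = cabs lam'.
Proof.
move=> l0 l'0 Yy y0 Ty Yy' y'0 Ty'.
have rel z l : T z = l *: z -> \forall k \ae mu,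
    cabs (w k) * cabs (rep z (phi k)) = cabs l * cabs (rep z k).
  move=> Tz; apply: filterS2 (weighted_wcomp z) (repZ HX l z) => k.
  by rewrite Tz => -> h; rewrite -!cabsM h.
apply: (log_integrable_eigenvalue phi_pres (rep_measurable HX y)
  (rep_measurable HX y') (Yint Yy y0) (Yint Yy' y'0) _ _ (rel _ _ Ty) (rel _ _ Ty')).
  by rewrite cabs_gt0.
by rewrite cabs_gt0.
Qed.

(** As [y o phi] vanishes almost nowhere, [w] vanishes almost everywhere. *)
Lemma kernel_zero y : Y y -> y <> 0 -> T y = 0 -> forall x, T x = 0.
Proof.
move=> Yy y0 Ty x; apply: (rep_eq HX).
have nz := preserving_ae phi_pres (log_integrable_neq0 (Yint Yy y0)).
have wy := weighted_wcomp y; rewrite Ty in wy.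
apply: filterS3 (filterI nz wy) (rep0 HX) (weighted_wcomp x) => k [h h1] h0 ->.
move: h1; rewrite h0 => /esym/eqP; rewrite mulf_eq0 (negbTE h) orbF => /eqP ->.
by rewrite mul0r.
Qed.

(** If the range had finite codimension, all numbers near [lam] would be
    eigenvalues, against the uniqueness of their modulus. *)
Lemma sigma1_sigma_ap : sigma1 Y T = sigma_ap Y T.
Proof.
apply/seteqP; split=> lam /=.
  move=> nF; apply: contrapT => /not_sigma_ap_Phi_plus[cR fk].
  by apply: nF; split=> //; left.
move=> ap [cR [fk|fc]]; first exact: (sigma_ap_not_Phi_plus ap).
have [t t0 ht] := @robust_codim_eigenvalues _ _ Y (as_linear weighted_linear) _ lam
  Y_sub Y_closed weighted_stable weighted_bound cT0 (robust ap) fc.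
have [l0|l0] := eqVneq lam 0.
  have [|y [Yy y0 Ty]] := ht 0; first by rewrite l0 subrr cabs0.
  have [|x [Yx x0 Tx]] := ht (t / 2)%:C.
    by rewrite l0 subr0 cabs_real ger0_norm ?divr_ge0 ?ltW//; lra.
  have T0 := kernel_zero Yy y0 (etrans Ty (scale0r y)).
  move: Tx => /=; rewrite T0 => /esym/eqP; rewrite scaler_eq0 => /orP[/eqP h|/eqP//].
  by have := congr1 cabs h; rewrite cabs0 cabs_real ger0_norm ?divr_ge0 ?ltW//; lra.
have cl : 0 < cabs lam by rewrite cabs_gt0.
pose s : R := t / (2 * cabs lam).
have s0 : 0 < s by rewrite divr_gt0// mulr_gt0.
have [|y [Yy y0 Ty]] := ht lam; first by rewrite subrr cabs0.
have [|x [Yx x0 Tx]] := ht ((1 + s)%:C * lam).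
  rewrite rmorphD mulrDl mul1r addrAC subrr add0r cabsM cabs_real ger0_norm ?(ltW s0)//.
  by rewrite /s; have -> : t / (2 * cabs lam) * cabs lam = t / 2; [field; rewrite gt_eqF|lra].
have s1 : 0 < 1 + s by rewrite addr_gt0.
have E := eigenvalue_modulus l0 _ Yy y0 Ty Yx x0 Tx.
have := E; rewrite cabsM cabs_real ger0_norm ?(ltW s1)// => /(_ _) h.
have : cabs lam = (1 + s) * cabs lam.
  by apply: h; rewrite mulf_neq0// -cabs_gt0 cabs_real ger0_norm ?(ltW s1).
by have := mulr_gt0 s0 cl; lra.
Qed.

End Main.

(** * Composition operators with spectrum in the unit circle *)

Section UnitarySpectrum.
Context {R : realType} {K : ptopologicalType} {mu : probability (borel K) R}.
Context {X : completeNormedModType R[i]} {rep : X -> K -> R[i]}.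
Hypothesis HX : Banach_ideal mu rep.
Variables (phi psi : borel K -> borel K) (U : X -> X).
Hypotheses (phi_pres : preserving mu phi) (psi_pres : preserving mu psi).
Hypotheses (phiK : cancel phi psi) (psiK : cancel psi phi).
Hypotheses (Ucomp : wcomp mu rep (cst 1) phi U).
Hypothesis U_spec : spectrum setT U `<=` unit_circle R[i].

Let invertible_off_circle (s : R) : 0 <= s -> s <> 1 ->
  invertible_on setT (fun y => s%:C *: y - U y).
Proof.
move=> s0 s1; apply: contrapT => /U_spec /=.
by rewrite /unit_circle /= normC_cabs cabs_real ger0_norm// => -[/s1].
Qed.

Let below_off_circle (s : R) : 0 <= s -> s <> 1 -> exists2 c : R, 0 <= c &
  forall x, rn x <= c * rn (s%:C *: x - U x).
Proof.
move=> s0 /(invertible_off_circle s0)/invertible_bounded_below[c c0 h].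
by exists c => // x; exact: h.
Qed.

Lemma inverse_composition_exists : exists V : X -> X,
  wcomp mu rep (cst 1) psi V /\
  exists2 c : R, 0 <= c & forall x, rn (V x) <= c * rn x.
Proof.
have n01 : (0 : R) <> 1 by move/eqP; rewrite eq_sym oner_eq0.
have [[_ _ sU] _] := invertible_off_circle (lexx 0) n01.
have [c c0 hc] := below_off_circle (lexx 0) n01.
have /choice[V hV] : forall x, exists y, U y = x.
  move=> x; have [//|y _ yx] := sU (- x).
  by exists y; apply: oppr_inj; rewrite -yx scale0r sub0r.
exists V; split=> [x|].
  have := preserving_ae psi_pres (Ucomp (V x)); rewrite hV.
  by apply: filterS => k; rewrite /= psiK !mul1r => ->.
exists c => // x; have := hc (V x).
by rewrite hV scale0r sub0r rnN.
Qed.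

Lemma composition_growth (c : R) : 0 <= c ->
  (forall x, rn (U x) <= c * rn x) ->
  forall s : R, 1 < s -> grows_at_most U s.
Proof.
move=> c0 hc; apply: (spectral_growth HX phi_pres Ucomp c0 hc) => s s1.
by apply: below_off_circle; [lra|move=> h; move: s1; rewrite h ltxx].
Qed.

(** Use [s - V = - s V (1 / s - U)]. *)
Lemma inverse_growth (V : X -> X) (cU cV : R) :
  wcomp mu rep (cst 1) psi V -> 0 <= cU -> (forall x, rn (U x) <= cU * rn x) ->
  0 <= cV -> (forall x, rn (V x) <= cV * rn x) ->
  forall s : R, 1 < s -> grows_at_most V s.
Proof.
move=> Vcomp cU0 hU cV0 hV.
apply: (spectral_growth HX psi_pres Vcomp cV0 hV) => s s1.
have s0 : 0 < s by lra.
have sV0 : 0 <= s^-1 by rewrite invr_ge0 ltW.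
have [|c c0 hc] := below_off_circle sV0.
  by move/(congr1 GRing.inv); rewrite invrK invr1 => h; move: s1; rewrite h ltxx.
exists (c * s^-1 * cU) => [|x]; first by rewrite !mulr_ge0.
have VK : U (V x) = x by exact: (composition_inverse HX phi_pres phiK Vcomp Ucomp).
pose UL := as_linear (wcomp_linear HX phi_pres Ucomp).
have E : s^-1%:C *: x - U x = - (s^-1%:C *: U (s%:C *: x - V x)).
  have -> : U (s%:C *: x - V x) = s%:C *: U x - x.
    by rewrite -[LHS]/(UL (s%:C *: x - V x)) linearB linearZ /= VK.
  by rewrite scalerBr scalerA -rmorphM mulVf ?gt_eqF// scale1r opprB.
apply: (le_trans (hc x)); rewrite E rnN rnZ cabs_real ger0_norm//.
by rewrite -!mulrA !ler_wpM2l.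
Qed.

End UnitarySpectrum.

Lemma Linfty_bound (R : realType) (K : ptopologicalType)
    (mu : probability (borel K) R) (X : completeNormedModType R[i])
    (rep : X -> K -> R[i]) (w : K -> R[i]) (W : X -> X) :
  Banach_ideal mu rep -> Linfty mu w -> is_multiplication mu rep w W ->
  exists2 c : R, 0 <= c & forall x, rn (W x) <= c * rn x.
Proof.
move=> HX [_ [c wc]] hW; exists (cabs c) => [|x]; first exact: cabs_ge0.
apply: (rn_dominated HX (cabs_ge0 c)); apply: filterS2 wc (hW x) => k h ->.
rewrite cabsM ler_wpM2r ?cabs_ge0// -le_cabs (le_trans h)//.
by rewrite ger0_norm// (le_trans _ h).
Qed.

Theorem theorem7p2 (R : realType) (K : ptopologicalType)
    (phi : K -> K) (mu : probability (borel K) R)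
    (X : completeNormedModType R[i]) (rep : X -> K -> R[i])
    (U : X -> X) (Y : set X) (w : K -> R[i]) (W : X -> X)
    (Kcompact : compact [set: K]) (Khausdorff : hausdorff_space K)
    (phi_homeo : homeomorphism phi)
    (mu_inv : invariant_measure mu phi) (mu_reg : regular_measure mu)
    (mu_open : forall O : set K, open O -> O !=set0 -> (0 < mu O)%E)
    (X_ideal : Banach_ideal mu rep) (X_center : center_is_Linfty mu rep)
    (U_comp : is_composition mu rep phi U) (U_bounded : bounded_op U)
    (U_spec : spectrum setT U `<=` unit_circle R[i])
    (mu_per : mu (periodic_points phi) = 0%E)
    (Y_sub : linear_subspace Y) (Y_closed : closed Y)
    (Y_loc : almost_localized mu rep Y) (UY : U @` Y = Y)
    (w_Linfty : Linfty mu w) (W_mul : is_multiplication mu rep w W)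
    (wY : W @` Y `<=` Y) :
  let T := W \o U in
  (sigma2 Y T = sigma_ap Y T /\ rotation_invariant (sigma_ap Y T)) /\
  ((forall y, Y y -> y <> 0 -> finite_log_integral mu rep y) ->
   sigma1 Y T = sigma_ap Y T /\ spectrum Y T = sigma4 Y T).

Proof.
have [phi_cont [psi [psi_cont phiK psiK]]] := phi_homeo.
have phi_pres : preserving mu (phi : borel K -> borel K).
  by split=> [|A mA]; [exact: continuous_borel|exact: mu_inv].
have mpsi := continuous_borel psi_cont.
have psi_pres : preserving mu (psi : borel K -> borel K).
  split=> // A mA; rewrite -mu_inv; last by rewrite -[_ @^-1` _]setTI; exact: mpsi.
  by congr (mu _); apply/seteqP; split=> k /=; rewrite phiK.
have Ucomp : wcomp mu rep (cst 1) (phi : borel K -> borel K) U.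
  by move=> x; apply: filterS (U_comp x) => k ->; rewrite mul1r.
have [cU [cU0 hU]] := bounded_opP U_bounded.
have [V [Vcomp [cV cV0 hV]]] :=
  inverse_composition_exists psi_pres psiK Ucomp U_spec.
have [cW cW0 hW] := Linfty_bound X_ideal w_Linfty W_mul.
have growU := composition_growth X_ideal phi_pres Ucomp U_spec cU0 hU.
have growV := inverse_growth X_ideal phi_pres psi_pres phiK Ucomp U_spec Vcomp
  cU0 hU cV0 hV.
have Yloc := almost_localized_restr X_ideal X_center Y_loc.
have [mw _] := w_Linfty.
move=> T; split; first split.
- exact: (sigma2_sigma_ap X_ideal Khausdorff phi_cont phi_pres psi_pres phiK psiK
    mu_reg mu_per Ucomp Vcomp cU0 hU cV0 hV cW0 hW growU growV Y_sub Y_closed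
    UY wY mw W_mul Yloc).
- exact: (sigma_ap_rotation X_ideal Khausdorff phi_cont phi_pres psi_pres phiK psiK
    mu_reg mu_per Ucomp Vcomp cU0 hU cV0 hV cW0 hW growU growV Y_sub
    UY wY mw W_mul Yloc).
move=> Ylog; split.
- exact: (sigma1_sigma_ap X_ideal Khausdorff phi_cont phi_pres psi_pres phiK psiK
    mu_reg mu_per Ucomp Vcomp cU0 hU cV0 hV cW0 hW growU growV Y_sub Y_closed
    UY wY mw W_mul Yloc Ylog).
- exact: (spectrum_sigma4 X_ideal Khausdorff phi_cont phi_pres psi_pres phiK psiK
    mu_reg mu_per Ucomp Vcomp cU0 hU cV0 hV cW0 hW growU growV Y_sub Y_closed
    UY wY mw W_mul Yloc).
Qed.
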